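(* Let $(E,(P_t)_{t\ge 0},obs)$ be a CTMP and $0<c<1$. Then $\overline{\delta}^c=\lambda^c$, where $\delta^c_0(x,y)=|obs(x)-obs(y)|$, $\delta^c_{n+1}=\mathcal{F}_c(\delta^c_n)$, $\overline{\delta}^c=\sup_n\delta^c_n$, and $\lambda^c(x,y)=\sup_{f\in\Lambda_c}|f(x)-f(y)|$.
   Context: $E$ is a locally compact Hausdorff space with a countable base, equipped with its Borel $\sigma$-algebra; $E$ is Polish, with topology $\mathcal{O}$. A CTMP consists of: a strongly continuous semigroup $(\hat P_t)_{t\ge 0}$ of bounded linear operators on $C_0(E)$ (continuous functions vanishing at infinity, sup norm), $\hat P_0=I$, $\hat P_s\hat P_t=\hat P_{s+t}$, with $0\le f\le 1 \Rightarrow 0\le \hat P_t f\le 1$; associated Markov kernels $P_t$ with $\hat P_t f(x)=\int f(y)\,P_t(x,\mathrm{d}y)$, honest ($P_t(x,E)=1$; write $P_t(x)=P_t(x,\cdot)$); a continuous $obs:E\to[0,1]$; and $x_n\to x$ implies $P_t(x_n)\to P_t(x)$ weakly for every $t$. $W(m)(\mu,\nu)=\inf_{\gamma\in\Gamma(\mu,\nu)}\int m\,\mathrm{d}\gamma$ over couplings $\Gamma(\mu,\nu)$, for lower semicontinuous $m$; $\mathcal{F}_c(m)(x,y)=\sup_{t\ge0}c^tW(m)(P_t(x),P_t(y))$ for lower semicontinuous 1-bounded pseudometrics $m$. The logic $\Lambda$ is generated by the grammar $f::= q \mid obs \mid \min\{f_1,f_2\}\mid 1-f\mid f\ominus q\mid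 \langle t\rangle f$ with $q\in[0,1]\cap\mathbb{Q}$, $t\in\mathbb{Q}_{\ge0}$. $\Lambda_c$ denotes its interpretation as functions $E\to[0,1]$: $q(x)=q$, $obs(x)=obs(x)$, $\min\{f_1,f_2\}(x)=\min\{f_1(x),f_2(x)\}$, $(1-f)(x)=1-f(x)$, $(f\ominus q)(x)=\max\{0,f(x)-q\}$, $(\langle t\rangle f)(x)=c^t\int f(y)\,P_t(x,\mathrm{d}y)$. *)

(* Defs.v *)
From HB Require Import structures.
From mathcomp Require Import all_boot all_order all_algebra.
From mathcomp Require Import all_classical all_reals all_analysis.

Set Implicit Arguments.
Unset Strict Implicit.
Unset Printing Implicit Defensive.

Import Order.TTheory GRing.Theory Num.Theory.
Import numFieldTopology.Exports numFieldNormedType.Exports.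

Local Open Scope classical_set_scope.
Local Open Scope ring_scope.

Notation borel E := (g_sigma_algebraType (@open E)).

Definition C0 (R : realType) (E : topologicalType) : set (E -> R) :=
  [set f | continuous f /\
    forall e : R, 0 < e ->
      exists2 K : set E, compact K & forall x, ~ K x -> `|f x| < e].

(* The set is bounded for f in C0. *)
Definition supnorm (R : realType) (E : Type) (f : E -> R) : R :=
  sup (range (fun x => `|f x|)).

(* An operator on C0(E) is a map on all functions E -> R of which only the
   restriction to C0(E) matters. *)
Definition bounded_linear_C0 (R : realType) (E : topologicalType)
    (T : (E -> R) -> (E -> R)) : Prop :=
  [/\ forall f, C0 f -> C0 (T f),
      forall (a : R) f g, C0 f -> C0 g ->
        T (fun x => a * f x + g x) = (fun x => a * T f x + T g x)
    & exists M : R, forall f, C0 f -> supnorm (T f) <= M * supnorm f].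

(* Only the operators [T t] with [0 <= t] matter. *)
Record Feller_semigroup (R : realType) (E : topologicalType)
    (T : R -> (E -> R) -> (E -> R)) : Prop := {
  fs_bounded_linear : forall t : R, 0 <= t -> bounded_linear_C0 (T t) ;
  fs_id : forall f, C0 f -> T 0 f = f ;
  fs_comp : forall (s t : R) f, 0 <= s -> 0 <= t -> C0 f ->
    T s (T t f) = T (s + t) f ;
  fs_strongly_continuous : forall f, C0 f ->
    supnorm (fun x => T t f x - f x) @[t --> 0^'+] --> (0 : R) ;
  fs_sub_markov : forall (t : R) f, 0 <= t -> C0 f ->
    (forall x, 0 <= f x <= 1) -> forall x, 0 <= T t f x <= 1
}.

Definition weak_cvg (R : realType) (E : ptopologicalType)
    (mu_ : nat -> {measure set (borel E) -> \bar R})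
    (mu : {measure set (borel E) -> \bar R}) : Prop :=
  forall f : E -> R, continuous f -> bounded_fun f ->
    \int[mu_ n]_y f y @[n --> \oo] --> \int[mu]_y f y.

Record CTMP (R : realType) (E : ptopologicalType) := {
  ctmp_semigroup : R -> (E -> R) -> (E -> R) ;
  ctmp_kernel : R -> R.-pker (borel E) ~> (borel E) ;
  ctmp_obs : E -> R ;
  ctmp_semigroupP : Feller_semigroup ctmp_semigroup ;
  ctmp_kernelE : forall (t : R) f x, 0 <= t -> C0 f ->
    ctmp_semigroup t f x = \int[ctmp_kernel t x]_y f y ;
  ctmp_obs_continuous : continuous ctmp_obs ;
  ctmp_obs01 : forall x, 0 <= ctmp_obs x <= 1 ;
  ctmp_kernel_weak : forall (t : R) (x_ : nat -> E) (x : E), 0 <= t ->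
    x_ @ \oo --> x ->
    weak_cvg (fun n => ctmp_kernel t (x_ n)) (ctmp_kernel t x)
}.

Definition couplings (R : realType) (d : measure_display)
    (T : measurableType d) (mu nu : {measure set T -> \bar R}) :
    set (probability (T * T)%type R) :=
  [set g | forall A : set T, measurable A ->
     g (A `*` setT) = mu A /\ g (setT `*` A) = nu A].

Definition Wasserstein (R : realType) (d : measure_display)
    (T : measurableType d) (m : T -> T -> \bar R)
    (mu nu : {measure set T -> \bar R}) : \bar R :=
  ereal_inf [set (\int[g]_z m z.1 z.2)%E | g in couplings mu nu].

Definition Fc (R : realType) (E : ptopologicalType) (X : CTMP R E) (c : R)
    (m : E -> E -> \bar R) (x y : E) : \bar R :=
  ereal_sup [set ((c `^ t)%:E *
      @Wasserstein R _ (borel E) m (ctmp_kernel X t x) (ctmp_kernel X t y))%E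
    | t in [set t : R | 0 <= t]].

Fixpoint delta (R : realType) (E : ptopologicalType) (X : CTMP R E) (c : R)
    (n : nat) : E -> E -> \bar R :=
  if n is n'.+1 then Fc X c (delta X c n')
  else fun x y => (`|ctmp_obs X x - ctmp_obs X y|)%:E.

Definition delta_bar (R : realType) (E : ptopologicalType) (X : CTMP R E)
    (c : R) (x y : E) : \bar R :=
  ereal_sup (range (fun n => delta X c n x y)).

Inductive formula : Type :=
| FConst (q : rat) of 0 <= q <= 1
| FObs
| FMin of formula & formula
| FNeg of formula
| FSub (f : formula) (q : rat) of 0 <= q <= 1
| FDiamond (t : rat) of 0 <= t & formula.

Fixpoint interp (R : realType) (E : ptopologicalType) (X : CTMP R E) (c : R)
    (phi : formula) : E -> R :=
  match phi with
  | FConst q _ => fun=> ratr q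
  | FObs => ctmp_obs X
  | FMin f1 f2 => fun x => Num.min (interp X c f1 x) (interp X c f2 x)
  | FNeg f => fun x => 1 - interp X c f x
  | FSub f q _ => fun x => Num.max 0 (interp X c f x - ratr q)
  | FDiamond t _ f => fun x =>
      c `^ (ratr t) * \int[ctmp_kernel X (ratr t) x]_y interp X c f y
  end.

Definition Lambda (R : realType) (E : ptopologicalType) (X : CTMP R E)
    (c : R) : set (E -> R) := range (interp X c).

Definition lambda (R : realType) (E : ptopologicalType) (X : CTMP R E)
    (c : R) (x y : E) : \bar R :=
  ereal_sup [set (`|f x - f y|)%:E | f in Lambda X c].

(* Main.v *)
Require Import Defs.
From HB Require Import structures.
From mathcomp Require Import all_boot all_order all_algebra.
From mathcomp Require Import all_classical all_reals all_analysis.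
From mathcomp Require Import measurable_realfun ring lra.

(**
Each formula [f] satisfies [|f x - f y| <= delta_n x y] for some [n], by
induction on [f]: the modality costs one application of [Fc], and raising [n] is
harmless because [<0> f = f].

Conversely, on a compact set [K] each [delta_n] is dominated, up to any
[e > 0], by [|f x - f y|] for [f] in a finite set of formulas.  This goes by
induction on [n].  Times beyond [t0] with [c ^ t0 <= e] are negligible, and the
laws [P_t x], for [t <= t0] and [x] in [K], are uniformly tight (Dini, using that
[P_t] is Feller and honest), so that [delta_n] may be replaced, on a larger
compact set, by the maximum of [|f_j x - f_j y|] over finitely many formulas
[f_j].  Rounding the values of the [f_j] to a grid of mesh [1 / M] turns the
transport problem into a finite one: its optimal plan, spread out as a product
measure on each pair of cells, is a coupling on [E], and an optimal potential,
rounded to the grid, is the restriction of a formula built from the [f_j] by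
[min], [max] and truncated sums; there are finitely many of those.  Finally
[t |-> P_t g] is continuous uniformly on [K], so finitely many rational times
suffice.
*)

Set Implicit Arguments.
Unset Strict Implicit.
Unset Printing Implicit Defensive.

Import Order.TTheory GRing.Theory Num.Theory.
Import numFieldTopology.Exports numFieldNormedType.Exports.

Local Open Scope classical_set_scope.
Local Open Scope ring_scope.

(** * Finite optimal transport *)

Section finite_duality.
Variable R : realFieldType.

(** Chooses the eliminated variable between its lower bounds [s1] and its upper bounds [s2]; either
    list may be empty. *)
Lemma separating_value (s1 s2 : seq R) :
  (forall a b, a \in s1 -> b \in s2 -> a <= b) ->
  exists v, (forall a, a \in s1 -> a <= v) /\ (forall b, b \in s2 -> v <= b).
Proof.
elim: s1 => [_|a s1 IH le12].
  elim: s2 => [|b s2 [v [_ IH]]]; first by exists 0.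
  exists (Num.min b v); split=> // x; rewrite inE => /orP[/eqP->|/IH vx].
    by rewrite ge_min lexx.
  by rewrite ge_min vx orbT.
have [|v [le1 le2]] := IH.
  by move=> x y xs ys; apply: le12 => //; rewrite inE xs orbT.
exists (Num.max a v); split=> [x|y ys].
  by rewrite inE le_max => /orP[/eqP->|/le1->]; rewrite ?lexx ?orbT.
by rewrite ge_max le2 // le12 // mem_head.
Qed.

(* Fourier-Motzkin elimination. [Q] abstracts the cone generated by [L], so
   that the Farkas multipliers can be read off in any convenient form. *)
Lemma farkas_cone (J : finType) (Q : {ffun J -> R} -> R -> Prop)
    (L : seq ({ffun J -> R} * R)) :
  (forall a b a' b', Q a b -> Q a' b' -> Q [ffun j => a j + a' j] (b + b')) ->
  (forall (r : R) a b, 0 < r -> Q a b -> Q [ffun j => r * a j] (r * b)) ->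
  (forall l, l \in L -> Q l.1 l.2) ->
  (exists x : J -> R, forall l, l \in L -> \sum_j l.1 j * x j <= l.2) \/
  (exists2 b : R, b < 0 & Q [ffun=> 0] b).
Proof.
move=> QD QZ.
(* Induction on the list [s] of variables that may still occur in the constraints. *)
suff elim_vars (s : seq J) : forall L : seq ({ffun J -> R} * R),
    (forall l, l \in L -> forall j, j \notin s -> l.1 j = 0) ->
    (forall l, l \in L -> Q l.1 l.2) ->
    (exists x : J -> R, forall l, l \in L -> \sum_j l.1 j * x j <= l.2) \/
    (exists2 b : R, b < 0 & Q [ffun=> 0] b).
  by apply: (elim_vars (enum J)) => l _ j; rewrite mem_enum.
elim: s {L} => [|j s IH] L suppL QL.
  (* No variable is left, so each constraint reads [0 <= l.2], and a violated one is itself the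
     certificate. *)
  have [/allP L0|/allPn[l lL]] := boolP (all (fun l => 0 <= l.2) L).
    left; exists (fun=> 0) => l lL.
    by rewrite big1 ?L0 // => j _; rewrite mulr0.
  rewrite -ltNge => l0; right; exists l.2 => //.
  suff <- : l.1 = [ffun=> 0] by exact: QL.
  by apply/ffunP => i; rewrite ffunE (suppL l).
(* For [l] in [Lpos] and [l'] in [Lneg] both factors are positive, and the coefficient of [j]
   cancels. *)
pose comb (l l' : {ffun J -> R} * R) :=
  ([ffun i => - l'.1 j * l.1 i + l.1 j * l'.1 i],
   - l'.1 j * l.2 + l.1 j * l'.2) : {ffun J -> R} * R.
pose Lpos := [seq l : {ffun J -> R} * R <- L | 0 < l.1 j].
pose Lneg := [seq l : {ffun J -> R} * R <- L | l.1 j < 0].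
pose L' := [seq l : {ffun J -> R} * R <- L | l.1 j == 0] ++
  [seq comb l l' | l <- Lpos, l' <- Lneg].
have [||[x xL']|] := IH L'; last by right.
- move=> l; rewrite mem_cat mem_filter => /orP[/andP[/eqP lj0 lL] i nis|].
    have [->//|ij] := eqVneq i j.
    by apply: (suppL l) => //; rewrite inE negb_or ij.
  case/allpairsP => -[l1 l2] /= [].
  rewrite !mem_filter => /andP[_ l1L] /andP[_ l2L] -> i nis /=; rewrite ffunE.
  have [->|ij] := eqVneq i j; first by ring.
  by rewrite !(suppL _ _ i) ?inE ?negb_or ?ij //; ring.
- move=> l; rewrite mem_cat mem_filter => /orP[/andP[_ /QL//]|].
  case/allpairsP => -[l1 l2] /= [].
  rewrite !mem_filter => /andP[l1j l1L] /andP[l2j l2L] -> /=.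
  have := QD _ _ _ _ (QZ (- l2.1 j) _ _ _ (QL _ l1L)) (QZ _ _ _ l1j (QL _ l2L)).
  rewrite oppr_gt0 => /(_ l2j); congr (Q _ _).
  by apply/ffunP => i; rewrite !ffunE.
(* [rest l / l.1 j] bounds the variable [j] from above on [Lpos] and from below on [Lneg]; the
   combined constraints say exactly that these bounds are compatible. *)
pose rest (l : {ffun J -> R} * R) := l.2 - \sum_(i | i != j) l.1 i * x i.
have sumE (l : {ffun J -> R} * R) (y : J -> R) :
    \sum_i l.1 i * y i = l.1 j * y j + \sum_(i | i != j) l.1 i * y i.
  by rewrite (bigD1 j).
have [|v [lov hiv]] := @separating_value
    [seq rest l / l.1 j | l <- Lneg] [seq rest l / l.1 j | l <- Lpos].
  move=> _ _ /mapP[l' + ->] /mapP[l + ->].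
  rewrite !mem_filter => /andP[l'j l'L] /andP[lj lL].
  have : comb l l' \in L'.
    rewrite mem_cat; apply/orP; right; apply/allpairsP; exists (l, l') => /=.
    by rewrite !mem_filter lj l'j lL l'L.
  move/xL'; rewrite sumE /= ffunE.
  under eq_bigr do rewrite ffunE mulrDl -!mulrA.
  rewrite big_split /= -!mulr_sumr => le_comb.
  rewrite ler_pdivlMr // mulrAC ler_ndivrMr // /rest.
  lra.
left; exists (fun i => if i == j then v else x i) => l lL.
rewrite sumE eqxx.
rewrite [X in _ + X](_ : _ = \sum_(i | i != j) l.1 i * x i); last first.
  by apply: eq_bigr => i /negPf ->.
rewrite -lerBrDr -/(rest l).
have [lj|lj|lj0] := ltgtP (l.1 j) 0.
- rewrite mulrC -ler_ndivrMr //; apply: lov; apply/mapP; exists l => //.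
  by rewrite mem_filter lj.
- rewrite mulrC -ler_pdivlMr //; apply: hiv; apply/mapP; exists l => //.
  by rewrite mem_filter lj.
rewrite lj0 mul0r /rest subr_ge0.
have := xL' l; rewrite sumE lj0 mul0r add0r; apply.
by rewrite mem_cat mem_filter lj0 eqxx lL.
Qed.

Lemma finite_argmin (I : finType) (i0 : I) (F : I -> R) :
  exists i, forall j, F i <= F j.
Proof.
by case: (@arg_minP _ _ _ i0 predT F) => // i _ iP; exists i => j; exact: iP.
Qed.

(** Transport plans of cost at most [D] are the solutions of a linear system. If it had none, Farkas
    multipliers would produce a potential with values in [0, 1] whose gap exceeds [D]. *)
Lemma finite_kantorovich_rubinstein (I : finType) (p q : I -> R)
    (d : I -> I -> R) (D : R) :
  (forall k, 0 <= p k) -> (forall k, 0 <= q k) ->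
  \sum_k p k = 1 -> \sum_k q k = 1 ->
  (forall k, d k k = 0) -> (forall k l, d k l <= 1) ->
  (forall k l m, d k m <= d k l + d l m) ->
  (forall h : I -> R, (forall k, 0 <= h k <= 1) ->
    (forall k l, h k - h l <= d k l) ->
    \sum_k h k * p k - \sum_k h k * q k <= D) ->
  exists g : I -> I -> R, [/\ forall k l, 0 <= g k l,
    forall k, \sum_l g k l = p k, forall l, \sum_k g k l = q l &
    \sum_k \sum_l g k l * d k l <= D].
Proof.
move=> p0 q0 p1 q1 d0 d1 dtri hD.

case: (pickP (fun _ : I => true)) => [i0 _|I0]; last first.
  by move: p1; rewrite big_pred0 // => /eqP; rewrite eq_sym oner_eq0.
pose F := {ffun I * I -> R}.
pose nonneg z0 : F * R := ([ffun z => - (z == z0)%:R], 0).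
pose row (e : R) k0 : F * R := ([ffun z => e * (z.1 == k0)%:R], e * p k0).
pose col (e : R) l0 : F * R := ([ffun z => e * (z.2 == l0)%:R], e * q l0).
pose cost : F * R := ([ffun z => d z.1 z.2], D).
pose L : seq (F * R) := cost :: [seq nonneg z | z : I * I] ++
  [seq row 1 k | k : I] ++ [seq row (-1) k | k : I] ++
  [seq col 1 k | k : I] ++ [seq col (-1) k | k : I].
(* [u] and [v] are multipliers of the row and column equations, hence of any sign, and [s] is that
   of the cost bound. Multipliers of the sign constraints are absorbed into the inequality on
   [a]. *)
pose Q (a : F) (b : R) := exists u v : I -> R, exists s : R, [/\ 0 <= s,
  forall k l, a (k, l) <= u k + v l + s * d k l &
  \sum_k u k * p k + \sum_k v k * q k + s * D <= b].
have sum_delta (f : I -> R) k0 : \sum_k (k == k0)%:R * f k = f k0.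
  rewrite (bigD1 k0) //= eqxx mul1r big1 ?addr0 // => k /negPf->.
  by rewrite mul0r.
have [|||[x xL]|[b b0 [u [v [s [s0 uv upvq]]]]]] := @farkas_cone _ Q L.
- move=> a b a' b' [u [v [s [s0 le lb]]]] [u' [v' [s' [s'0 le' lb']]]].
  exists (fun k => u k + u' k), (fun k => v k + v' k), (s + s'); split.
  + exact: addr_ge0.
  + by move=> k l; rewrite ffunE; have := le k l; have := le' k l; lra.
  + under eq_bigr do rewrite mulrDl.
    under [X in _ + X + _]eq_bigr do rewrite mulrDl.
    by rewrite !big_split /=; lra.
- move=> r a b r0 [u [v [s [s0 le lb]]]].
  exists (fun k => r * u k), (fun k => r * v k), (r * s); split.
  + by rewrite mulr_ge0 // ltW.
  + move=> k l; rewrite ffunE -mulrA -!mulrDr ler_pM2l //; exact: le.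
  + under eq_bigr do rewrite -mulrA.
    under [X in _ + X + _]eq_bigr do rewrite -mulrA.
    by rewrite -!mulr_sumr -mulrA -!mulrDr ler_pM2l.
- have Qrow e k0 : Q (row e k0).1 (row e k0).2.
    exists (fun k => e * (k == k0)%:R), (fun=> 0), 0; split => //=.
      by move=> k l; rewrite ffunE /=; lra.
    rewrite [X in _ + X + _]big1 => [|k _]; last by rewrite mul0r.
    under eq_bigr do rewrite -mulrA.
    by rewrite -mulr_sumr sum_delta; lra.
  have Qcol e k0 : Q (col e k0).1 (col e k0).2.
    exists (fun=> 0), (fun k => e * (k == k0)%:R), 0; split => //=.
      by move=> k l; rewrite ffunE /=; lra.
    rewrite [X in X + _ + _]big1 => [|k _]; last by rewrite mul0r.
    under eq_bigr do rewrite -mulrA.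
    by rewrite -mulr_sumr sum_delta; lra.
  move=> l; rewrite inE !mem_cat => /orP[/eqP->|].
    exists (fun=> 0), (fun=> 0), 1; split => //=.
      by move=> k m; rewrite ffunE /=; lra.
    by rewrite !big1 => [|k _|k _]; rewrite ?mul0r //; lra.
  case/orP=> [/fintype.imageP[z _ ->]|].
    exists (fun=> 0), (fun=> 0), 0; split => //=.
      by move=> k m; rewrite ffunE; have := ler0n R ((k, m) == z); lra.
    by rewrite !big1 => [|k _|k _]; rewrite ?mul0r //; lra.
  case/or4P => /fintype.imageP[z _ ->].
  + exact: Qrow.
  + exact: Qrow.
  + exact: Qcol.
  + exact: Qcol.
- exists (fun k l => x (k, l)).
  have pairE (f : I * I -> R) : \sum_z f z = \sum_k \sum_l f (k, l).
    by rewrite pair_bigA; apply: eq_bigr => -[].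
  have rowE e k0 : \sum_z (row e k0).1 z * x z = e * \sum_l x (k0, l).
    rewrite pairE (bigD1 k0) //= [X in _ + X]big1 => [|k kk0].
      rewrite addr0 mulr_sumr; apply: eq_bigr => l _.
      by rewrite ffunE /= eqxx mulr1.
    by rewrite big1 // => l _; rewrite ffunE /= (negPf kk0) mulr0 mul0r.
  have colE e l0 : \sum_z (col e l0).1 z * x z = e * \sum_k x (k, l0).
    rewrite pairE mulr_sumr; apply: eq_bigr => k _.
    rewrite (bigD1 l0) //= big1 => [|l ll0].
      by rewrite ffunE /= eqxx mulr1 addr0.
    by rewrite ffunE /= (negPf ll0) mulr0 mul0r.
  have Lrow e k : e \in [:: 1; -1] -> row e k \in L.
    rewrite inE mem_seq1 => /orP[]/eqP->; rewrite inE !mem_cat;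
    by rewrite (fintype.image_f (row _)) ?orbT.
  have Lcol e k : e \in [:: 1; -1] -> col e k \in L.
    rewrite inE mem_seq1 => /orP[]/eqP->; rewrite inE !mem_cat;
    by rewrite (fintype.image_f (col _)) ?orbT.
  split.
  + move=> k l; have := xL (nonneg (k, l)).
    rewrite inE mem_cat fintype.image_f ?orbT //= => /(_ isT).
    rewrite (bigD1 (k, l)) //= ffunE eqxx big1 => [|z /negPf zkl].
      by rewrite addr0 mulN1r oppr_le0.
    by rewrite ffunE zkl oppr0 mul0r.
  + move=> k; have := xL (row 1 k); have := xL (row (-1) k).
    rewrite !Lrow ?inE ?eqxx ?orbT // => /(_ isT) + /(_ isT).
    by rewrite !rowE /= => ? ?; apply/le_anti/andP; split; lra.
  + move=> k; have := xL (col 1 k); have := xL (col (-1) k).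
    rewrite !Lcol ?inE ?eqxx ?orbT // => /(_ isT) + /(_ isT).
    by rewrite !colE /= => ? ?; apply/le_anti/andP; split; lra.
  + have := xL cost; rewrite mem_head => /(_ isT) /=; rewrite pairE.
    congr (_ <= _); apply: eq_bigr => k _; apply: eq_bigr => l _.
    by rewrite ffunE mulrC.
exfalso.
have {}uv k l : 0 <= u k + v l + s * d k l by have := uv k l; rewrite ffunE.
have {upvq b b0}upvq : \sum_k u k * p k + \sum_k v k * q k + s * D < 0 by lra.
(* If [s = 0], then [u k + v l >= 0], and summing this against the product of [p] and [q]
   contradicts [upvq]. *)
have [s_eq0|s_neq0] := eqVneq s 0.
  move: upvq; rewrite s_eq0 mul0r addr0.
  suff -> : \sum_k u k * p k + \sum_k v k * q k =
      \sum_k \sum_l (u k + v l) * (p k * q l).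
    apply/negP; rewrite -leNgt; apply: sumr_ge0 => k _; apply: sumr_ge0 => l _.
    by rewrite !mulr_ge0 //; have := uv k l; rewrite s_eq0; lra.
  under [RHS]eq_bigr do under eq_bigr do rewrite mulrDl.
  under [RHS]eq_bigr do rewrite big_split /=.
  rewrite big_split /=; congr (_ + _).
    apply: eq_bigr => k _; under eq_bigr do rewrite mulrA.
    by rewrite -mulr_sumr q1 mulr1.
  rewrite exchange_big /=; apply: eq_bigr => l _.
  under eq_bigr do rewrite mulrCA mulrC.
  by rewrite -mulr_sumr p1 mulr1.
have {s_neq0}s0 : 0 < s by rewrite lt_neqAle eq_sym s_neq0.
(* the c-transform of the multiplier [v] *)
pose t k := [arg min_(l < i0) (s * d k l + v l)]%O.
have tP k l : s * d k (t k) + v (t k) <= s * d k l + v l.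
  by rewrite /t; case: arg_minP => // i _; apply.
pose h k := (s * d k (t k) + v (t k)) / s.
(* Subtracting the minimum brings [h] into [0, 1], since [d] is at most 1, and preserves the gap,
   since [p] and [q] have the same mass. *)
have [kmin hmin] := finite_argmin i0 h.
have hlip k l : h k - h l <= d k l.
  rewrite -mulrBl ler_pdivrMr //.
  have := tP k (t l); have := ler_wpM2l (ltW s0) (dtri k l (t l)).
  by rewrite mulrDr mulrC; lra.
have hle l : h l * s <= v l.
  by rewrite /h divfK ?gt_eqF //; have := tP l l; rewrite d0 mulr0 add0r.
have hge k : - u k <= h k * s.
  by rewrite /h divfK ?gt_eqF //; have := uv k (t k); lra.
have h01 k : 0 <= h k - h kmin <= 1.
  by rewrite subr_ge0 hmin /= (le_trans (hlip _ _)).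
have hlip' k l : h k - h kmin - (h l - h kmin) <= d k l.
  by have := hlip k l; lra.
have := hD _ h01 hlip'.
have -> : \sum_k (h k - h kmin) * p k - \sum_k (h k - h kmin) * q k =
    \sum_k h k * p k - \sum_k h k * q k.
  under eq_bigr do rewrite mulrBl; under [X in _ - X]eq_bigr do rewrite mulrBl.
  by rewrite !sumrB -!mulr_sumr p1 q1; ring.
have hp : - \sum_k u k * p k <= s * \sum_k h k * p k.
  rewrite mulr_sumr -sumrN; apply: ler_sum => k _.
  by rewrite mulrA -mulNr ler_wpM2r // mulrC.
have hq : s * \sum_k h k * q k <= \sum_k v k * q k.
  rewrite mulr_sumr; apply: ler_sum => k _.
  by rewrite mulrA ler_wpM2r // mulrC.
by rewrite -(ler_pM2l s0); lra.
Qed.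
End finite_duality.

(** * Functions vanishing at infinity *)

Section cutoff.
Variables (R : realType) (E : topologicalType).
Hypothesis E_locally_compact : locally_compact [set: E].
Hypothesis E_hausdorff : hausdorff_space E.

(** The one-point compactification is compact Hausdorff, hence normal: Urysohn separates the point
    at infinity from the image of [K]. *)
Lemma C0_cutoff (K : set E) : compact K -> exists f : E -> R,
  [/\ C0 f, forall x, 0 <= f x <= 1 & forall x, K x -> f x = 1].
Proof.
move=> cK; pose opc := one_point_compactification E.
have opcH : hausdorff_space opc by exact: one_point_compactification_hausdorff.
have opcN : normal_space opc.
  exact: compact_normal opcH one_point_compactification_compact.
have cl0 : closed [set (None : opc)].
  exact: accessible_closed_set1 (hausdorff_accessible opcH) _.
have clK : closed (Some @` K : set opc).
  apply: (compact_closed opcH); apply: continuous_compact cK.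
  apply: continuous_subspaceT.
  exact: one_point_compactification_some_continuous.
have dis : [set (None : opc)] `&` (Some @` K) = set0.
  by rewrite -subset0 => _ [/= -> [z _]].
move/normal_separatorP : opcN => /(_ R _ _ cl0 clK dis).
move=> /(@uniform_separatorP _ R)[f [cf f01 f0 f1]].
exists (f \o Some); split.
- split.
    move=> x; apply: continuous_comp; last exact: cf.
    exact: one_point_compactification_some_continuous.
  move=> e e0.
  have fN0 : f None = 0 by apply: f0; exists None.
  have : \forall z \near (None : opc), `|f z| < e.
    have /cvgrPdist_lt/(_ e e0) := cf (None : opc).
    by apply: filterS => z; rewrite fN0 sub0r normrN.
  case=> C [cC _] CU; exists C => // x nCx.
  by apply: CU; left; exists x.
- move=> x; have : range f (f (Some x)) by exists (Some x).
  by move/f01; rewrite /= in_itv.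
- by move=> x Kx; apply: f1; exists (Some x) => //; exists x.
Qed.

Lemma compact_cover_seq : @second_countable E ->
  exists K_ : nat -> set E, (forall n, compact (K_ n)) /\
    forall x, exists n, K_ n x.
Proof.
move=> [B cB [_ Bb]].
have /countable_injP[i iinj] := cB.
pose U n := xget set0 [set V | [/\ B V, precompact V & i V = n]].
exists (fun n => closure (U n)); split=> [n|x].
  rewrite /U; case: xgetP => [V _ [_ + _]|_]; first by rewrite precompactE.
  by rewrite closure0; exact: compact0.
have [W xW pW] : exists2 W, nbhs x W & precompact W.
  have [W xW [cW clW]] := E_locally_compact (x := x) I.
  exists W; last by rewrite precompact_closed.
  have {}xW : nbhs x (fun z => [set: E] z -> W z) := xW.
  by apply: filterS xW => z; exact.
have [V [BV Vx] VW] := Bb x _ xW.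
exists (i V); apply: subset_closure; rewrite /U; case: xgetP => [V' _|].
  move=> [BV' _ ii]; suff -> : V' = V by [].
  by apply: iinj => //; rewrite inE.
by move=> /(_ V)[]; split=> //; exact: precompact_subset pW.
Qed.

Lemma C0_exhaustion : @second_countable E -> exists f_ : nat -> E -> R,
  [/\ forall n, C0 (f_ n), forall n x, 0 <= f_ n x <= 1,
      forall n x, f_ n x <= f_ n.+1 x & forall x, exists n, f_ n x = 1].
Proof.
case/compact_cover_seq => K_ [cK K_cover].
have /choice[g gP] : forall n, exists f : E -> R,
    [/\ C0 f, forall x, 0 <= f x <= 1 & forall x, K_ n x -> f x = 1].
  by move=> n; exact: C0_cutoff.
(* The operation [a + b - a * b], that is [1 - (1 - a) * (1 - b)], dominates both arguments, stays
   in [0, 1] and preserves [C0]. *)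
pose f_ := fix f_ n := if n is m.+1
  then (fun x => f_ m x + g n x - f_ m x * g n x) else g 0.
have f01 n x : 0 <= f_ n x <= 1.
  elim: n => [|n IH] /=; first by have [_ + _] := gP 0; exact.
  by have [_ /(_ x) gx _] := gP n.+1; nra.
exists f_; split=> //.
- elim=> [|n IH]; first by have [] := gP 0.
  have [cf f0] := IH; have [[cg g0] g01 _] := gP n.+1; split.
    move=> x; apply: cvgB; first by apply: cvgD; [exact: cf|exact: cg].
    by apply: cvgM; [exact: cf|exact: cg].
  move=> e e0; have e2 : 0 < e / 2 by lra.
  have [K1 cK1 K1P] := f0 _ e2; have [K2 cK2 K2P] := g0 _ e2.
  exists (K1 `|` K2); first exact: compactU.
  move=> x /not_orP[/K1P + /K2P]; rewrite /=.
  have := f01 n x; have := g01 x => /andP[? ?] /andP[? ?].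
  by rewrite !ger0_norm //; nra.
- by move=> n x /=; have := f01 n x; have [_ /(_ x) gx _] := gP n.+1; nra.
- move=> x; have [n Kx] := K_cover x; exists n.
  have [_ _ /(_ x Kx) g1] := gP n.
  by case: n Kx g1 => //= n Kx ->; ring.
Qed.

End cutoff.

(** * Integrals against probability measures *)

Section probability_integral.
Variables (R : realType) (d : measure_display) (T : measurableType d).
Variable mu : {measure set T -> \bar R}.
Hypothesis mu1 : mu setT = 1%E.

Lemma prob_fin_num (A : set T) : measurable A -> mu A \is a fin_num.
Proof.
move=> mA; rewrite ge0_fin_numE //.
apply: (@le_lt_trans _ _ (mu setT)); last by rewrite mu1 ltry.
by apply: le_measure; rewrite ?inE.
Qed.

Lemma integrable_normr_le (f : T -> R) (M : R) :
  measurable_fun setT f -> (forall x, `|f x| <= M) ->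
  mu.-integrable setT (EFin \o f).
Proof.
move=> mf fM; apply: measurable_bounded_integrable => //.
  by rewrite mu1 ltry.
exists M; split; first exact: num_real.
by move=> y My x _; apply: le_trans (fM x) (ltW My).
Qed.

Lemma Rintegral_prob_cst (r : R) : \int[mu]_x r = r.
Proof. by rewrite Rintegral_cst // mu1 mulr1. Qed.

Lemma Rintegral_prob_dist (f g : T -> R) (M e : R) :
  measurable_fun setT f -> (forall x, `|f x| <= M) ->
  measurable_fun setT g -> (forall x, `|g x| <= M) ->
  (forall x, `|f x - g x| <= e) ->
  `|\int[mu]_x f x - \int[mu]_x g x| <= e.
Proof.
move=> mf fM mg gM fg.
have fi := integrable_normr_le mf fM; have gi := integrable_normr_le mg gM.
have mfg : measurable_fun setT (fun x => f x - g x) by exact: measurable_funB.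
rewrite -RintegralB //; apply: le_trans (le_normr_Rintegral _ _) _ => //.
  exact: integrable_normr_le fg.
rewrite -[leRHS]Rintegral_prob_cst; apply: le_Rintegral => //.
- apply: (@integrable_normr_le _ e); first exact: measurableT_comp.
  by move=> x; rewrite normr_id.
- by apply: (@integrable_normr_le _ `|e|) => //; exact: measurable_cst.
Qed.

End probability_integral.

Lemma continuous_borel_measurable (R : realType) (E : ptopologicalType)
  (f : E -> R) : continuous f -> measurable_fun [set: borel E] f.
Proof.
move=> /continuousP cf; apply: (measurability _ (RGenOpens.measurableE R)).
move=> _ [_ [a [b ->]] <-]; rewrite setTI; apply: sub_sigma_algebra.
exact/cf/interval_open.
Qed.

Lemma compact_borel_measurable (E : ptopologicalType) (K : set (borel E)) :
  hausdorff_space E -> @compact E K -> measurable K.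
Proof.
move=> hE cK; rewrite -[K]setCK; apply: measurableC; apply: sub_sigma_algebra.
by rewrite /= openC; exact: compact_closed.
Qed.

Section C0_facts.
Variables (R : realType) (E : topologicalType).

Lemma C0_bounded (f : E -> R) : C0 f -> exists M, forall x, `|f x| <= M.
Proof.
move=> [cf f0]; have [K cK fK] := f0 1 ltr01.
have cfK : compact (f @` K).
  by apply: continuous_compact cK; exact: continuous_subspaceT.
have [M [_ /(_ (M + 1))]] := compact_bounded cfK; rewrite ltrDl ltr01.
move=> /(_ isT) fM; exists (Num.max 1 (M + 1)) => x; rewrite le_max.
have [Kx|nKx] := pselect (K x); last by rewrite ltW ?fK.
by rewrite [X in _ || X]fM ?orbT //; exists x.
Qed.

Lemma supnorm_ubound (f : E -> R) x : (exists M, forall x, `|f x| <= M) ->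
  `|f x| <= supnorm f.
Proof.
move=> [M fM]; apply: sup_upper_bound; last by exists x.
split; first by exists `|f x|; exists x.
by exists M => _ [y _ <-].
Qed.

Lemma C0B (f g : E -> R) : C0 f -> C0 g -> C0 (fun x => f x - g x).
Proof.
move=> [cf f0] [cg g0]; split.
  by move=> x; apply: cvgB; [exact: cf|exact: cg].
move=> e e0; have e2 : 0 < e / 2 by lra.
have [K1 cK1 K1P] := f0 _ e2; have [K2 cK2 K2P] := g0 _ e2.
exists (K1 `|` K2); first exact: compactU.
move=> x /not_orP[/K1P fx /K2P gx].
by apply: le_lt_trans (ler_normB _ _) _; lra.
Qed.

Lemma C0_mul01 (f g : E -> R) : continuous f -> (forall x, 0 <= f x <= 1) ->
  C0 g -> C0 (fun x => f x * g x).
Proof.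
move=> cf f01 [cg g0]; split.
  by move=> x; apply: cvgM; [exact: cf|exact: cg].
move=> e /g0[K cK KP]; exists K => // x /KP; apply: le_lt_trans.
have /andP[f0 f1] := f01 x.
by rewrite normrM ger0_norm // ler_piMl.
Qed.
End C0_facts.

Section integral_tools.
Variables (R : realType) (d : measure_display) (T : measurableType d).
Variable mu : {measure set T -> \bar R}.

(* The integral of a nonnegative function is a supremum over the simple
   functions below it, so monotonicity does not need measurability. *)
Lemma le_integral_nonmeasurable (f g : T -> \bar R) :
  (forall x, 0 <= f x)%E -> (forall x, f x <= g x)%E ->
  (\int[mu]_x f x <= \int[mu]_x g x)%E.
Proof.
move=> f0 fg; rewrite !ge0_integralTE //; last first.
  by move=> x; apply: le_trans (fg x).
apply: le_ereal_sup => _ [h hf <-]; exists h => // x.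
exact: le_trans (hf x) (fg x).
Qed.

Lemma ge0_integral_sum_indic (J : finType) (w : J -> R) (A : J -> set T) :
  (forall j, 0 <= w j) -> (forall j, measurable (A j)) ->
  (\int[mu]_x (\sum_j (w j)%:E * (\1_(A j) x)%:E) =
    \sum_j (w j)%:E * mu (A j))%E.
Proof.
move=> w0 mA; rewrite ge0_integral_sum //.
- apply: eq_bigr => j _; rewrite ge0_integralZl_EFin //.
    by rewrite integral_indic // setIT.
  by apply/measurable_EFinP; exact: measurable_indic.
- move=> j; apply: measurable_funeM; apply/measurable_EFinP.
  exact: measurable_indic.
- by move=> j x _; rewrite mule_ge0 ?lee_fin.
Qed.

Lemma measure_partition (I : finType) (a : T -> I) (B : set T) :
  (forall i, measurable (a @^-1` [set i])) -> measurable B ->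
  mu B = (\sum_i mu (B `&` a @^-1` [set i]))%E.
Proof.
move=> ma mB; rewrite -[in LHS](setIT B) -integral_indic //.
transitivity (\sum_i 1%:E * mu (B `&` a @^-1` [set i]))%E; last first.
  by apply: eq_bigr => i _; rewrite mul1e.
rewrite -ge0_integral_sum_indic // => [|i]; last exact: measurableI.
apply: eq_integral => x _; rewrite (bigD1 (a x)) //= big1 => [|i ix].
  rewrite adde0 mul1e; congr (_%:E); rewrite !indicE.
  congr ((nat_of_bool _)%:R); apply/idP/idP; rewrite !inE /=; first by [].
  by case.
rewrite mul1e indicE memNset // => -[_ /= xi].
by rewrite xi eqxx in ix.
Qed.
End integral_tools.

(** * Uniform tightness and time regularity of the kernels *)

(** Factor out [c ^ q <= 1] and use [1 + u <= exp u] at [u = (t - q) * ln c]. *)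
Lemma powR_dist_le (R : realType) (c q t : R) : 0 < c -> c < 1 -> 0 <= q <= t ->
  `|c `^ t - c `^ q| <= (t - q) * - ln c.
Proof.
move=> c0 c1 /andP[q0 qt].
have c01 : 0 <= c <= 1 by rewrite !ltW.
have -> : c `^ t = c `^ q * c `^ (t - q).
  by rewrite -powRD ?subrKC // (gt_eqF c0) implybT.
have cq1 : c `^ q <= 1 by rewrite -[leRHS](powRr0 c) ger_powR // c0 ltW.
have cq0 : 0 <= c `^ q by exact: powR_ge0.
have ct1 : c `^ (t - q) <= 1.
  have tq : 0 <= t - q by rewrite subr_ge0.
  by rewrite -[leRHS](powRr0 c) ger_powR // c0 ltW.
have : 1 + (t - q) * ln c <= c `^ (t - q).
  by rewrite /powR gt_eqF // expR_ge1Dx.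
rewrite -{2}[c `^ q]mulr1 -mulrBr normrM ger0_norm // distrC.
rewrite ger0_norm ?subr_ge0 //.
move=> h; apply: le_trans (ler_piMl _ cq1) _; first by rewrite subr_ge0.
by lra.
Qed.

Section feller.
Variables (R : realType) (E : ptopologicalType) (X : CTMP R E).
Hypothesis E_locally_compact : locally_compact [set: E].
Hypothesis E_hausdorff : hausdorff_space E.
Hypothesis E_second_countable : @second_countable E.

Local Notation T := (ctmp_semigroup X).
Local Notation k := (ctmp_kernel X).
Local Notation P t g x := (\int[k t x]_y g y).

Let k1 t x : k t x setT = 1%E. Proof. exact: prob_kernel. Qed.

Let semigroupC0 t f : 0 <= t -> C0 f -> C0 (T t f).
Proof.
by move=> t0; have [+ _ _] := fs_bounded_linear (ctmp_semigroupP X) t0; exact.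
Qed.

Lemma kernel_C0_dist t x (f g : E -> R) (e : R) : C0 f -> C0 g ->
  (forall y, `|f y - g y| <= e) -> `|P t f x - P t g x| <= e.
Proof.
move=> Cf Cg fg; have [M1 fM] := C0_bounded Cf; have [M2 gM] := C0_bounded Cg.
have [[cf _] [cg _]] := (Cf, Cg).
apply: (@Rintegral_prob_dist _ _ _ _ _ _ _ (Num.max M1 M2)) => //.
- exact: continuous_borel_measurable.
- by move=> y; rewrite le_max fM.
- exact: continuous_borel_measurable.
- by move=> y; rewrite le_max gM orbT.
Qed.

(** For [s <= t], [T t f = T s (T (t - s) f)] and [T s] is a sup norm contraction, so strong
    continuity at 0 gives a modulus uniform in [s] and [x]. *)
Lemma semigroup_unif_continuous (f : E -> R) (e : R) : C0 f -> 0 < e ->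
  exists2 d, 0 < d & forall s t x, 0 <= s -> 0 <= t -> `|s - t| < d ->
    `|T s f x - T t f x| <= e.
Proof.
move=> Cf e0; have semi := ctmp_semigroupP X.
have /cvgrPdist_lt/(_ e e0) := fs_strongly_continuous semi Cf.
case=> d /= d0 dP; exists d => //.
suff le_case s t x : 0 <= s -> s <= t -> `|s - t| < d ->
    `|T s f x - T t f x| <= e.
  move=> s t x s0 t0 st; have [lst|/ltW lts] := leP s t; first exact: le_case.
  by rewrite distrC; apply: le_case => //; rewrite distrC.
move=> s0; rewrite le_eqVlt => /orP[/eqP-> _|st std].
  by rewrite subrr normr0 ltW.
have ts0 : 0 < t - s by rewrite subr_gt0.
have Cts := semigroupC0 (ltW ts0) Cf.
rewrite -[t](subrKC s) -(fs_comp semi) ?(ltW ts0) //.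
rewrite !(ctmp_kernelE X) //; apply: kernel_C0_dist => // y.
have := dP (t - s); rewrite /ball_ /= sub0r normrN (distrC t) => /(_ std ts0).
rewrite sub0r normrN => /ltW; apply: le_trans; rewrite distrC.
apply: le_trans (ler_norm _).
apply: (@supnorm_ubound _ _ (fun y => T (t - s) f y - f y)).
exact: C0_bounded (C0B Cts Cf).
Qed.

Let C0_01 (f : E -> R) : (forall x, 0 <= f x <= 1) -> forall x, `|f x| <= 1.
Proof. by move=> f01 x; have /andP[f0 f1] := f01 x; rewrite ger0_norm. Qed.

Lemma kernel_integrable_01 t x (f : E -> R) : continuous f ->
  (forall x, 0 <= f x <= 1) -> (k t x).-integrable setT (EFin \o f).
Proof.
move=> cf f01; apply: (integrable_normr_le (k1 t x)) (C0_01 f01).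
exact: continuous_borel_measurable.
Qed.

Let continuous_onem (f : E -> R) : continuous f ->
  continuous (fun y => 1 - f y).
Proof. by move=> cf y; apply: cvgB; [exact: cvg_cst|exact: cf]. Qed.

Lemma le_kernel_01 t x (f g : E -> R) : continuous f -> continuous g ->
  (forall x, 0 <= f x <= 1) -> (forall x, 0 <= g x <= 1) ->
  (forall y, f y <= g y) -> P t f x <= P t g x.
Proof.
move=> cf cg f01 g01 fg.
by apply: le_Rintegral => //; exact: kernel_integrable_01.
Qed.

Lemma kernel_01 t x (f : E -> R) : continuous f ->
  (forall x, 0 <= f x <= 1) -> 0 <= P t f x <= 1.
Proof.
move=> cf f01.
have cst01 (r : R) : continuous (fun _ : E => r) by move=> y; exact: cvg_cst.
rewrite -[X in X <= _](Rintegral_prob_cst (k1 t x)).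
rewrite -[X in _ <= _ <= X](Rintegral_prob_cst (k1 t x)).
rewrite !le_kernel_01 ?lexx ?ler01 // => y; rewrite ?lexx ?ler01 //.
  by have /andP[] := f01 y.
by have /andP[] := f01 y.
Qed.

Lemma kernel_onem t x (f : E -> R) : continuous f ->
  (forall x, 0 <= f x <= 1) -> P t (fun y => 1 - f y) x = 1 - P t f x.
Proof.
move=> cf f01; rewrite RintegralB // ?Rintegral_prob_cst //.
- apply: (@integrable_normr_le _ _ _ _ (k1 t x) _ 1).
    exact: measurable_cst.
  by move=> y; rewrite normr1.
- exact: kernel_integrable_01.
Qed.

(** Monotone convergence: the integrals increase to the total mass, which is 1 by honesty. *)
Lemma kernel_exhaustion (f_ : nat -> E -> R) t x (e : R) :
  (forall n, continuous (f_ n)) -> (forall n x, 0 <= f_ n x <= 1) ->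
  (forall n x, f_ n x <= f_ n.+1 x) -> (forall x, exists n, f_ n x = 1) ->
  0 < e -> exists n, 1 - e < P t (f_ n) x.
Proof.
move=> cf f01 f_incr f1 e0.
have ndf y : {homo (fun n => (f_ n y)%:E) : n m / (n <= m)%N >-> (n <= m)%E}.
  by apply/nondecreasing_seqP => n; rewrite lee_fin.
have := @cvg_monotone_convergence _ _ _ (k t x) setT measurableT
  (fun n y => (f_ n y)%:E) _ _ (fun y _ => ndf y).
have -> : (\int[k t x]_y (limn (fun n => (f_ n y)%:E)))%E = 1%E.
  rewrite (eq_integral (cst 1%E)) => [|y _].
    by rewrite integral_cst // mul1e.
  have [n fn1] := f1 y; apply: cvg_lim => //; apply: cvg_near_cst.
  exists n => // m /= nm; apply/eqP; rewrite eqe eq_le.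
  have /andP[_ ->] := f01 m y; rewrite -fn1.
  by have := ndf y _ _ nm; rewrite lee_fin.
move=> cvg1.
have {}cvg1 : (\int[k t x]_y (f_ n y)%:E)%E @[n --> \oo] --> 1%E.
  apply: cvg1 => [n|n y _].
    by apply/measurable_EFinP; exact: continuous_borel_measurable.
  by rewrite lee_fin; have /andP[] := f01 n y.
have : \forall n \near \oo, ((1 - e)%:E < \int[k t x]_y (f_ n y)%:E)%E.
  have lt1 : ((1 - e)%:E < 1%:E)%E by rewrite lte_fin; lra.
  exact: (cvg1 _ (open_ereal_gt' lt1)).
case=> n _ /(_ n (leqnn n)) h; exists n.
rewrite -lte_fin /Rintegral fineK //; apply: integrable_fin_num => //.
exact: kernel_integrable_01.
Qed.

(** Dini's argument on the compact set [[0, t0] x K]: a bound at one point extends to a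
    neighbourhood by joint continuity of [T s f y] and to later indices by monotonicity. *)
Lemma feller_tight (K : set E) (t0 e : R) : compact K -> 0 < e ->
  exists f : E -> R, [/\ C0 f, forall x, 0 <= f x <= 1 &
    forall t x, 0 <= t <= t0 -> K x -> 1 - e <= P t f x].
Proof.
move=> cK e0.
have [f_ [Cf f01 f_incr f1]] :=
  C0_exhaustion R E_locally_compact E_hausdorff E_second_countable.
have f_nd m n y : (m <= n)%N -> f_ m y <= f_ n y.
  by move: m n; apply/nondecreasing_seqP.
have ctf n : continuous (f_ n) by have [] := Cf n.
have cTK : compact (`[0, t0] `*` K).
  by apply: compact_setX => //; exact: segment_compact.
move/compact_near_coveringP: cTK => /(_ nat \oo
  (* The guard discards the negative times met in neighbourhoods of 0, where the semigroup laws say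
     nothing. *)
  (fun n z => 0 <= z.1 -> 1 - e <= P z.1 (f_ n) z.2) _)[|N _ /(_ N (leqnn N)) NP].
  move=> [t x] [/=]; rewrite in_itv /= => /andP[t_ge0 _] Kx.
  have e2 : 0 < e / 2 by lra. have e4 : 0 < e / 4 by lra.
  have [n nP] := kernel_exhaustion t x ctf f01 f_incr f1 e2.
  have [d d0 dP] := semigroup_unif_continuous (Cf n) e4.
  have [cT _] := semigroupC0 t_ge0 (Cf n).
  have /cvgrPdist_lt/(_ _ e4) xV := cT x.
  pose V := [set y | `|T t (f_ n) x - T t (f_ n) y| < e / 4].
  exists (ball t d `*` V, [set m | (n <= m)%N]).
    split=> /=; last by exists n.
    by exists (ball t d, V) => //=; split=> //=; exact: nbhsx_ballx.
  move=> [[s y] m] [/= [ts xy] nm] s0.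
  have {}xy : `|T t (f_ n) x - T t (f_ n) y| < e / 4 := xy.
  apply: le_trans (le_kernel_01 s y (ctf n) (ctf m) (f01 n) (f01 m) _); last first.
    by move=> z; exact: f_nd.
  rewrite -(ctmp_kernelE X) //.
  have := dP t s y t_ge0 s0 ts.
  move: nP xy; rewrite -(ctmp_kernelE X) // => nP.
  by rewrite ltr_norml ler_norml => /andP[? ?] /andP[? ?]; lra.
exists (f_ N); split=> // t x /andP[t_ge0 tt0] Kx.
by apply: (NP (t, x)) => //; split=> //=; rewrite in_itv /= t_ge0.
Qed.

(** [K'] is a superlevel set of the function given by [feller_tight]. The indicator of its
    complement is at most [1 + e / 2 - f], whose integral is at most [e]. *)
Lemma feller_tight_set (K : set E) (t0 e : R) : compact K -> 0 < e ->
  exists2 K' : set E, compact K' &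
    forall t x, 0 <= t <= t0 -> K x -> (k t x (~` K') <= e%:E)%E.
Proof.
move=> cK e0; have e2 : 0 < e / 2 by lra.
have [f [Cf f01 fP]] := feller_tight t0 cK e2; have [cf f0] := Cf.
pose K' := [set y | e / 2 <= f y]; exists K'.
  have [C cC CP] := f0 _ e2; apply: (subclosed_compact _ cC).
    by apply: closed_comp (@closed_ge _ _) => y _; exact: cf.
  move=> y /= ey; apply: contrapT => /CP; rewrite ltNge => /negP; apply.
  exact: le_trans ey (ler_norm _).
have mK' : measurable (~` K' : set (borel E)).
  rewrite (_ : ~` K' = f @^-1` `]-oo, (e / 2)[%classic); last first.
    apply/seteqP; split => y /=; rewrite in_itv /= ltNge => /negP //.
  rewrite -[X in measurable X]setTI.
  by apply: (continuous_borel_measurable cf).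
move=> t x tt0 Kx.
have cF : continuous (fun y => (1 + e / 2) - f y).
  by move=> y; apply: cvgB; [exact: cvg_cst|exact: cf].
have F0 y : 0 <= (1 + e / 2) - f y by have /andP[] := f01 y; lra.
rewrite -[X in k t x X]setIT -integral_indic //.
apply: (@le_trans _ _ (\int[k t x]_y ((1 + e / 2) - f y)%:E)%E).
  apply: le_integral_nonmeasurable => y; rewrite lee_fin ?indicE //.
  have [/=|//] := boolP (y \in _); rewrite inE => /negP; rewrite -ltNge => fy.
  by lra.
have bnd y : `|(1 + e / 2) - f y| <= 1 + e / 2.
  by rewrite ger0_norm //; have /andP[] := f01 y; lra.
rewrite -[leLHS]fineK; last first.
  apply: integrable_fin_num => //.
  exact: (integrable_normr_le (k1 t x) (continuous_borel_measurable cF) bnd).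
rewrite lee_fin -/(Rintegral _ _ _) RintegralB //; last 2 first.
- apply: (@integrable_normr_le _ _ _ _ (k1 t x) _ (1 + e / 2)).
    exact: measurable_cst.
  by move=> y; rewrite ger0_norm //; lra.
- exact: kernel_integrable_01.
by rewrite Rintegral_prob_cst //; have := fP t x tt0 Kx; lra.
Qed.

(** Carries regularity of the semigroup on [C0] over to bounded continuous functions: take
    [h = g * f] with [f] from [feller_tight], so that [0 <= g - h <= 1 - f]. *)
Lemma feller_C0_approx (g : E -> R) (K : set E) (t0 e : R) :
  continuous g -> (forall x, 0 <= g x <= 1) -> compact K -> 0 < e ->
  exists h : E -> R, [/\ C0 h, forall x, h x <= g x &
    forall t x, 0 <= t <= t0 -> K x -> `|P t g x - T t h x| <= e].
Proof.
move=> cg g01 cK e0; have [f [Cf f01 fP]] := feller_tight t0 cK e0.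
have [cf _] := Cf.
have Cgf := C0_mul01 cg g01 Cf; have [cgf _] := Cgf.
have gf01 x : 0 <= g x * f x <= 1.
  have /andP[? ?] := g01 x; have /andP[? ?] := f01 x.
  by rewrite mulr_ge0 // mulr_ile1.
have gfg x : g x * f x <= g x.
  by have /andP[? ?] := g01 x; have /andP[? ?] := f01 x; rewrite ler_piMr.
exists (fun x => g x * f x); split=> // t x tt0 Kx.
rewrite (ctmp_kernelE X) //; last by case/andP: tt0.
rewrite -RintegralB //; [|exact: kernel_integrable_01..].
have cD : continuous (fun y => g y - g y * f y).
  by move=> y; apply: cvgB; [exact: cg|exact: cgf].
have D01 y : 0 <= g y - g y * f y <= 1.
  by have := gfg y; have /andP[? ?] := g01 y; have /andP[? ?] := gf01 y; lra.
have cF := continuous_onem cf.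
rewrite ger0_norm; last by have /andP[] := kernel_01 t x cD D01.
apply: (@le_trans _ _ (P t (fun y => 1 - f y) x)).
  apply: le_kernel_01 => // y; have /andP[? ?] := g01 y; have /andP[? ?] := f01 y.
    by lra.
  by nra.
by rewrite kernel_onem //; have := fP t x tt0 Kx; lra.
Qed.

Lemma kernel0 x (g : E -> R) : continuous g -> (forall x, 0 <= g x <= 1) ->
  P 0 g x = g x.
Proof.
(* The approximation from below gives one inequality; the other is the same inequality for
   [1 - g]. *)
suff le_g (h : E -> R) : continuous h -> (forall x, 0 <= h x <= 1) ->
    P 0 h x <= h x.
  move=> cg g01; apply/le_anti; rewrite le_g //=.
  have := le_g _ (continuous_onem cg); rewrite kernel_onem // lerD2l lerN2; apply => y.
  by have := g01 y; lra.
move=> ch h01; apply/ler_addgt0Pr => e e0.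
have [f [Cf fh /(_ 0 x)]] := feller_C0_approx 0 ch h01 (@compact_set1 E x) e0.
rewrite lexx => /(_ isT erefl); rewrite fs_id //; last exact: ctmp_semigroupP.
by rewrite ler_norml => /andP[_]; have := fh x; lra.
Qed.

(** On a compact neighbourhood of [x] the function is a uniform limit of the continuous functions
    [T t h]. *)
Lemma kernel_continuous t (g : E -> R) : 0 <= t ->
  continuous g -> (forall x, 0 <= g x <= 1) -> continuous (fun x => P t g x).
Proof.
move=> t_ge0 cg g01 x; apply/cvgrPdist_le => e e0.
have [W xW [cW _]] := E_locally_compact (x := x) I.
have {}xW : nbhs x (fun z => [set: E] z -> W z) := xW.
have e3 : 0 < e / 3 by lra.
have [h [Ch _ hP]] := feller_C0_approx t cg g01 cW e3.
have [cT _] := semigroupC0 t_ge0 Ch.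
have /cvgrPdist_lt/(_ _ e3) xV := cT x.
have Wx : W x by exact: (nbhs_singleton xW).
near=> y.
have Wy : W y by near: y; apply: filterS xW => z; exact.
have : `|T t h x - T t h y| < e / 3 by near: y.
have := hP t x; have := hP t y; rewrite t_ge0 lexx => /(_ isT Wy) + /(_ isT Wx).
rewrite !ltr_norml !ler_norml => /andP[? ?] /andP[? ?] /andP[? ?].
by apply/andP; split; lra.
Unshelve. all: by end_near. Qed.

Lemma finite_time_net (c : R) (g : E -> R) (K : set E) (t0 e : R) :
  0 < c -> c < 1 -> continuous g -> (forall x, 0 <= g x <= 1) -> compact K ->
  0 <= t0 -> 0 < e ->
  exists s : seq rat, (forall q, q \in s -> 0 <= q) /\
    forall t, 0 <= t <= t0 -> exists2 q, q \in s &
      forall x, K x ->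
        `|c `^ t * P t g x - c `^ (ratr q) * P (ratr q) g x| <= e.
Proof.
move=> c_gt0 c_lt1 cg g01 cK t0_ge0 e0; have e4 : 0 < e / 4 by lra.
have [h [Ch _ hP]] := feller_C0_approx t0 cg g01 cK e4.
have [d d0 dP] := semigroup_unif_continuous Ch e4.
have lnc : ln c < 0 by rewrite ln_lt0 // c_gt0.
(* [N] exceeds the sum of two nonnegative terms, hence each of them: the time mesh [1 / N] is below
   [d], and the discount varies by at most [e / 4] over it. *)
pose N := (Num.truncn (d^-1 - ln c * (e / 4)^-1)).+1.
have N0 : 0 < N%:R :> R by rewrite ltr0n.
have NP : d^-1 - ln c * (e / 4)^-1 < N%:R by rewrite truncnS_gt.
have ei : 0 < (e / 4)^-1 by rewrite invr_gt0.
have di : 0 < d^-1 by rewrite invr_gt0.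
have Nd : N%:R^-1 < d.
  rewrite invf_plt ?posrE // (le_lt_trans _ NP) // lerDl oppr_ge0.
  by rewrite nmulr_rle0 // ltW.
have Ne : N%:R^-1 * - ln c <= e / 4.
  rewrite mulrC ler_pdivrMr // mulrC -ler_pdivrMr // mulNr ltW //.
  by rewrite (le_lt_trans _ NP) // lerDr ltW.
exists [seq j%:R / N%:R | j <- iota 0 (Num.truncn (t0 * N%:R)).+1]; split.
  by move=> q /mapP[j _ ->]; rewrite divr_ge0.
move=> t /andP[t_ge0 tt0].
have tN0 : 0 <= t * N%:R by rewrite mulr_ge0 // ltW.
pose j := Num.truncn (t * N%:R).
have /andP[jle jlt] : j%:R <= t * N%:R < j.+1%:R by exact: truncn_itv.
(* Rounding [t] down keeps the rational time in [[0, t0]], where the approximation by [h] is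
   valid. *)
exists (j%:R / N%:R : rat).
  apply/mapP; exists j => //; rewrite mem_iota /= add0n ltnS le_truncn //.
  by rewrite ler_wpM2r // ltW.
rewrite fmorph_div /= !ratr_nat; set q : R := _ / _.
have q0 : 0 <= q by rewrite divr_ge0 // ltW.
have qt : q <= t by rewrite ler_pdivrMr.
have tq : t - q <= N%:R^-1.
  by rewrite lerBlDl /q -[X in _ + X]mul1r -mulrDl ler_pdivlMr // natr1 ltW.
move=> x Kx.
have ct : `|c `^ t - c `^ q| <= e / 4.
  apply: le_trans (powR_dist_le c_gt0 c_lt1 _) (le_trans _ Ne); first by rewrite q0.
  by rewrite ler_wpM2r // oppr_ge0 ltW.
have cq0 : 0 <= c `^ q by exact: powR_ge0.
have cq1 : c `^ q <= 1 by rewrite -[leRHS](powRr0 c) ger_powR // c_gt0 ltW.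
have /andP[p0 p1] := kernel_01 t x cg g01.
have PP : `|P t g x - P q g x| <= 3 * (e / 4).
  have := hP t x; have := hP q x; rewrite q0 t_ge0 tt0 (le_trans qt) //.
  move=> /(_ isT Kx) + /(_ isT Kx); have := dP t q x t_ge0 q0.
  rewrite [`|t - q|]ger0_norm ?subr_ge0 // => /(_ (le_lt_trans tq Nd)).
  rewrite !ler_norml => /andP[? ?] /andP[? ?] /andP[? ?].
  by apply/andP; split; lra.
rewrite [X in `|X|](_ : _ = (c `^ t - c `^ q) * P t g x +
  c `^ q * (P t g x - P q g x)); last by ring.
apply: le_trans (ler_normD _ _) _; rewrite !normrM (ger0_norm p0) (ger0_norm cq0).
have : `|c `^ t - c `^ q| * P t g x <= `|c `^ t - c `^ q| by rewrite ler_piMr.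
have : c `^ q * `|P t g x - P q g x| <= `|P t g x - P q g x| by rewrite ler_piMl.
by lra.
Qed.

End feller.

(** * Couplings *)

Lemma probability_of_measure (R : realType) (d : measure_display)
    (T : measurableType d) (mu : {measure set T -> \bar R}) :
  mu setT = 1%E -> exists P : probability T R, P = mu :> (set T -> \bar R).
Proof.
move=> mu1.
pose P : probability T R := mnormalize mu (dirac point).
exists P; apply/funext => U; rewrite /P /= /mnormalize mu1.
by rewrite onee_eq0 /= invr1 mule1.
Qed.

Section block_coupling.
Variables (R : realType) (d : measure_display) (T : measurableType d).
Variables (mu nu : {measure set T -> \bar R}).
Hypotheses (mu1 : mu setT = 1%E) (nu1 : nu setT = 1%E).
Variables (I : finType) (a : T -> I) (g : I -> I -> R).
Let A i := a @^-1` [set i].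
Hypothesis ma : forall i, measurable (A i).
Hypothesis g0 : forall i j, 0 <= g i j.
Hypothesis g_row : forall i, (\sum_j g i j)%:E = mu (A i).
Hypothesis g_col : forall j, (\sum_i g i j)%:E = nu (A j).

Let p i := \sum_j g i j.
Let q j := \sum_i g i j.
(** Density of the coupling with respect to the product of [mu] and [nu] on a pair of cells. Where
    the denominator vanishes it is 0 by convention, and [g] vanishes there too, as [wpq] shows. *)
Let w (z : I * I) : R := g z.1 z.2 / (p z.1 * q z.2).

Let p0 i : 0 <= p i. Proof. exact: sumr_ge0. Qed.
Let q0 i : 0 <= q i. Proof. exact: sumr_ge0. Qed.
Let w0 z : 0 <= w z.
Proof. by rewrite divr_ge0 ?mulr_ge0. Qed.

Let wpq i j : w (i, j) * (p i * q j) = g i j.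
Proof.
rewrite /w /=; have [pq0|pq0] := eqVneq (p i * q j) 0; last by rewrite divfK.
rewrite pq0 mulr0; apply/esym/eqP; rewrite eq_le g0 andbT.
move/eqP: pq0; rewrite mulf_eq0 => /orP[]/eqP <-; rewrite /p /q.
  by rewrite (bigD1 j) //= lerDl sumr_ge0.
by rewrite (bigD1 i) //= lerDl sumr_ge0.
Qed.

Let sum_pair (V : nmodType) (f : I * I -> V) :
  \sum_z f z = \sum_i \sum_j f (i, j).
Proof. by rewrite pair_bigA; apply: eq_bigr => -[]. Qed.

Let measure_fineE (m : {measure set T -> \bar R}) B : m setT = 1%E -> measurable B ->
  m B = (fine (m B))%:E.
Proof. by move=> m1 mB; rewrite fineK // prob_fin_num. Qed.

Lemma block_coupling : exists2 G : probability (T * T)%type R,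
  couplings mu nu G & forall i j, G (A i `*` A j) = (g i j)%:E.
Proof.
have [mu' mu'E] := probability_of_measure mu1.
have [nu' nu'E] := probability_of_measure nu1.
pose D (z : I * I) := A z.1 `*` A z.2.
have mD z : measurable (D z) by exact: measurableX.
pose base z : {measure set (T * T)%type -> \bar R} :=
  mscale (NngNum (w0 z)) (mrestr (mu' \x nu')%E (mD z)).
(* [msum] sums a family indexed by [nat], so the pairs are enumerated, with the zero measure past
   the end. *)
pose z_ i := nth None [seq Some z | z <- enum {: I * I}] i.
pose fam i : {measure set (T * T)%type -> \bar R} :=
  if z_ i is Some z then base z else mzero.
pose G0 : {measure set (T * T)%type -> \bar R} := msum fam #|{: I * I}|.
have G0E B C : measurable B -> measurable C ->
    G0 (B `*` C) = (\sum_i \sum_j w (i, j) *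
      (fine (mu (B `&` A i)) * fine (nu (C `&` A j))))%:E.
  move=> mB mC.
  have -> : G0 (B `*` C) = (\sum_z base z (B `*` C))%E.
    pose F o := if o is Some z then base z (B `*` C) else 0%E.
    transitivity (\sum_(o <- [seq Some z | z <- enum {: I * I}]) F o)%E.
      rewrite (big_nth None) size_map -cardE big_mkord.
      by apply: eq_bigr => i _; rewrite /fam /z_; case: nth.
    by rewrite big_map big_enum.
  rewrite sum_pair /= -sumEFin; apply: eq_bigr => i _.
  rewrite -sumEFin; apply: eq_bigr => j _.
  rewrite /base /= /mscale /= /mrestr /D /= -setXI.
  rewrite (product_measure1E mu' nu') ; [|exact: measurableI..].
  have mBi : measurable (B `&` A i) by exact: measurableI.
  have mCj : measurable (C `&` A j) by exact: measurableI.
  rewrite [RHS]EFinM; congr (_ * _)%E; rewrite [RHS]EFinM.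
  rewrite -(measure_fineE mu1 mBi) -(measure_fineE nu1 mCj).
  by congr (_ * _)%E; [exact: (congr1 (@^~ _) mu'E)|exact: (congr1 (@^~ _) nu'E)].
have muA i : fine (mu (setT `&` A i)) = p i by rewrite setTI -g_row.
have nuA i : fine (nu (setT `&` A i)) = q i by rewrite setTI -g_col.
have finA (m : {measure set T -> \bar R}) B i : m setT = 1%E -> measurable B ->
    0 <= fine (m (B `&` A i)) <= fine (m (setT `&` A i)).
  move=> m1 mB; rewrite fine_ge0 //= -lee_fin -!measure_fineE //;
    [|exact: measurableI..].
  by apply: le_measure; rewrite ?inE; [exact: measurableI..|exact: setSI].
have G0l B : measurable B -> G0 (B `*` setT) = mu B.
  move=> mB; rewrite G0E // (measure_partition mu ma mB) -sumEFin.
  apply: eq_bigr => i _; rewrite [RHS](measure_fineE mu1 (measurableI _ _ mB (ma i))).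
  congr (_%:E); under eq_bigr do rewrite nuA.
  have := finA mu B i mu1 mB; rewrite muA.
  (* On a null cell [finA] forces [mu (B]&[A i)] to be 0, so both sides vanish. *)
  have [->|pi0] := eqVneq (p i) 0.
    by move=> /le_anti <-; rewrite big1 // => j _; rewrite mul0r mulr0.
  move=> _; set r := fine _.
  transitivity (\sum_j r / p i * g i j).
    by apply: eq_bigr => j _; rewrite -wpq; field.
  by rewrite -mulr_sumr divfK.
have G0r B : measurable B -> G0 (setT `*` B) = nu B.
  move=> mB; rewrite G0E // (measure_partition nu ma mB) exchange_big /=.
  rewrite -sumEFin; apply: eq_bigr => j _.
  rewrite [RHS](measure_fineE nu1 (measurableI _ _ mB (ma j))).
  congr (_%:E); under eq_bigr do rewrite muA.
  have := finA nu B j nu1 mB; rewrite nuA.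
  have [->|qj0] := eqVneq (q j) 0.
    by move=> /le_anti <-; rewrite big1 // => i _; rewrite !mulr0.
  move=> _; set r := fine _.
  transitivity (\sum_i r / q j * g i j).
    by apply: eq_bigr => i _; rewrite -wpq; field.
  by rewrite -mulr_sumr divfK.
have G01 : G0 setT = 1%E by rewrite -[X in G0 X]setXTT G0l.
have [G GE] := probability_of_measure G01.
exists G; first by move=> B mB; rewrite GE G0l // G0r.
move=> i j; rewrite GE G0E // (bigD1 i) //= [X in _ + X]big1 => [|i' i'i].
  rewrite (bigD1 j) //= big1 => [|j' j'j].
    by rewrite !setIid -g_row -g_col /= !addr0; congr (_%:E); exact: wpq.
  rewrite [A j `&` _](_ : _ = set0) ?measure0 ?mulr0 //.
  by rewrite -subset0 => x [/= xj xj']; rewrite -xj -xj' eqxx in j'j.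
rewrite big1 // => j' _.
rewrite [A i `&` _](_ : _ = set0) ?measure0 ?mul0r ?mulr0 //.
by rewrite -subset0 => x [/= xi xi']; rewrite -xi -xi' eqxx in i'i.
Qed.

Lemma Wasserstein_block_le (m : T -> T -> \bar R) (K : set T) (D : I -> I -> R)
    (e1 e2 : R) :
  measurable K -> (mu (~` K) <= e2%:E)%E -> (nu (~` K) <= e2%:E)%E ->
  (forall i j, 0 <= D i j) -> 0 <= e1 ->
  (forall u v, 0 <= m u v <= 1)%E ->
  (forall u v, K u -> K v -> (m u v <= (D (a u) (a v) + e1)%:E)%E) ->
  (Wasserstein m mu nu <= (\sum_i \sum_j g i j * D i j + e1 + 2 * e2)%:E)%E.
Proof.
move=> mK muK nuK D0 e10 m01 mD; have [G Gmn GA] := block_coupling.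
have mKC : measurable (~` K) by exact: measurableC.
apply: (@le_trans _ _ (\int[G]_z m z.1 z.2)%E).
  by apply: ereal_inf_lbound; exists G.
(* A measurable majorant of [m]: [F1] is constant on pairs of cells and bounds [m] on [K x K], while
   [F2] and [F3] pay 1 where a coordinate leaves [K]. *)
pose F1 (z : T * T) : \bar R :=
  (\sum_ij (D ij.1 ij.2 + e1)%:E * (\1_(A ij.1 `*` A ij.2) z)%:E)%E.
pose F2 (z : T * T) : \bar R := (\1_(~` K `*` setT) z)%:E.
pose F3 (z : T * T) : \bar R := (\1_(setT `*` ~` K) z)%:E.
have F10 z : (0 <= F1 z)%E.
  by apply: sume_ge0 => ij _; rewrite mule_ge0 ?lee_fin ?addr_ge0.
have F20 z : (0 <= F2 z)%E by rewrite lee_fin.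
have F30 z : (0 <= F3 z)%E by rewrite lee_fin.
have mAA ij : measurable (A ij.1 `*` A ij.2) by exact: measurableX.
have mK1 : measurable (~` K `*` [set: T]) by exact: measurableX.
have mK2 : measurable ([set: T] `*` ~` K) by exact: measurableX.
have mF1 : measurable_fun setT F1.
  apply: emeasurable_sum => ij; apply: measurable_funeM.
  by apply/measurable_EFinP; exact: measurable_indic.
have mF2 : measurable_fun setT F2.
  by apply/measurable_EFinP; exact: measurable_indic.
have mF3 : measurable_fun setT F3.
  by apply/measurable_EFinP; exact: measurable_indic.
apply: (@le_trans _ _ (\int[G]_z (F1 z + (F2 z + F3 z)))%E).
  apply: le_integral_nonmeasurable => [z|[u v] /=].
    by have /andP[] := m01 z.1 z.2.
  have [Ku|nKu] := pselect (K u); last first.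
    have -> : F2 (u, v) = 1%E by rewrite /F2 indicE mem_set.
    have /andP[_ /le_trans] := m01 u v; apply.
    by rewrite addeA addeAC leeDr // adde_ge0.
  have [Kv|nKv] := pselect (K v); last first.
    have -> : F3 (u, v) = 1%E by rewrite /F3 indicE mem_set.
    have /andP[_ /le_trans] := m01 u v; apply.
    by rewrite addeA leeDr // adde_ge0.
  apply: le_trans (mD u v Ku Kv) _.
  apply: (@le_trans _ _ (F1 (u, v))); last by rewrite leeDl // adde_ge0.
  rewrite /F1 (bigD1 (a u, a v)) //= indicE mem_set // mule1 leeDl //.
  by apply: sume_ge0 => ij _; rewrite mule_ge0 ?lee_fin ?addr_ge0.
rewrite ge0_integralD //; last 2 first.
- by move=> z _; rewrite adde_ge0.
- exact: emeasurable_funD.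
rewrite ge0_integralD // !integral_indic // !setIT.
rewrite ge0_integral_sum_indic //; last first.
  by move=> ij; rewrite addr_ge0.
pose G' : {measure set (T * T)%type -> \bar R} := G.
have GK1 : G' (~` K `*` setT) = mu (~` K) := (Gmn _ mKC).1.
have GK2 : G' (setT `*` ~` K) = nu (~` K) := (Gmn _ mKC).2.
have GA' i j : G' (A i `*` A j) = (g i j)%:E := GA i j.
rewrite GK1 GK2.
have -> : (\sum_i \sum_j g i j * D i j + e1 + 2 * e2)%:E =
    ((\sum_i \sum_j g i j * D i j + e1)%:E + (e2%:E + e2%:E))%E.
  by rewrite -!EFinD; congr (_%:E); ring.
under eq_bigr do rewrite GA' -EFinM.
rewrite sumEFin !sum_pair /=; apply: leeD; last exact: leeD.
rewrite lee_fin.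
have g1 : \sum_i \sum_j g i j = 1.
  apply: EFin_inj; rewrite -sumEFin -mu1 (measure_partition mu ma measurableT).
  by apply: eq_bigr => i _; rewrite g_row setTI.
rewrite -{2}[e1]mul1r -g1 mulr_suml -big_split /=; apply: ler_sum => i _.
rewrite mulr_suml -big_split /=; apply: ler_sum => j _.
by rewrite mulrC mulrDr.
Qed.
End block_coupling.

Section coupling_integral.
Variables (R : realType) (d : measure_display) (T : measurableType d).
Variables (mu nu : {measure set T -> \bar R}) (g : T -> R).
Hypothesis mg : measurable_fun setT g.
Hypothesis g01 : forall x, 0 <= g x <= 1.

Let g1 x : `|g x| <= 1.
Proof. by have /andP[? ?] := g01 x; rewrite ger0_norm. Qed.

Let marginal_integral (m : {measure set T -> \bar R})
    (G : probability (T * T)%type R) (pi : T * T -> T) :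
  measurable_fun setT pi ->
  (forall A, measurable A -> G (pi @^-1` A) = m A) ->
  \int[m]_x g x = \int[G]_z g (pi z).
Proof.
move=> mpi Gm; rewrite /Rintegral; congr fine.
rewrite -(@eq_measure_integral _ _ _ _ _ (pushforward G pi)) => [|A mA _]; last first.
  exact: Gm.
rewrite (ge0_integral_pushforward mpi) //.
- by apply/measurable_EFinP.
- by move=> x _; rewrite lee_fin; have /andP[] := g01 x.
Qed.

(** The easy half of Kantorovich-Rubinstein duality: both integrals are rewritten under [G] through
    its marginals. *)
Lemma coupling_integral_dist (G : probability (T * T)%type R) :
  couplings mu nu G ->
  ((`|\int[mu]_x g x - \int[nu]_x g x|)%:E <=
    \int[G]_z (`|g z.1 - g z.2|)%:E)%E.
Proof.
move=> GP.
have G1 : G setT = 1%E by exact: probability_setT.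
rewrite (@marginal_integral mu G fst) //; last first.
  by move=> A mA; rewrite -(GP A mA).1; congr (G _); apply/seteqP; split => [z|z []].
rewrite (@marginal_integral nu G snd) //; last first.
  by move=> A mA; rewrite -(GP A mA).2; congr (G _); apply/seteqP; split => [z|z []].
have mg1 : measurable_fun [set: T * T] (fun z => g z.1).
  by exact: measurableT_comp.
have mg2 : measurable_fun [set: T * T] (fun z => g z.2).
  by exact: measurableT_comp.
have i1 : G.-integrable setT (EFin \o (fun z => g z.1)).
  by apply: (integrable_normr_le G1 mg1) => z; exact: g1.
have i2 : G.-integrable setT (EFin \o (fun z => g z.2)).
  by apply: (integrable_normr_le G1 mg2) => z; exact: g1.
rewrite -RintegralB //.
have mB := measurable_funB mg1 mg2.
have B2 z : `|g z.1 - g z.2| <= 2.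
  by rewrite (le_trans (ler_normB _ _)) //; have := g1 z.1; have := g1 z.2; lra.
have iB := integrable_normr_le G1 mB B2.
rewrite -[leRHS]fineK; last first.
  apply: integrable_fin_num => //.
  apply: (@integrable_normr_le _ _ _ _ G1 _ 2); first exact: measurableT_comp.
  by move=> z; rewrite normr_id.
by rewrite lee_fin; apply: le_normr_Rintegral.
Qed.

End coupling_integral.

(** * Discretised transport *)

(** Sup norm distance in the cube indexed by [J] between the value vector of [x] and a grid
    point. *)
Definition grid_dist (R : realType) (T : Type) (J : finType) (f : J -> T -> R)
    (M : nat) (k : {ffun J -> 'I_M.+1}) (x : T) : R :=
  \big[Num.max/0]_j `|f j x - (k j)%:R / M%:R|.

Section grid.
Variables (R : realType) (d : measure_display) (T : measurableType d).
Variables (mu nu : {measure set T -> \bar R}).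
Hypotheses (mu1 : mu setT = 1%E) (nu1 : nu setT = 1%E).
Variables (J : finType) (f : J -> T -> R) (M : nat).
Hypothesis M_gt0 : (0 < M)%N.
Hypothesis mf : forall j, measurable_fun setT (f j).
Hypothesis f01 : forall j x, 0 <= f j x <= 1.

(** [M + 1] levels per coordinate, because values are rounded down and the value 1 has index [M]. *)
Let I : finType := {ffun J -> 'I_M.+1}.
Let D (k l : I) : R := \big[Num.max/0]_j `|(k j)%:R / M%:R - (l j)%:R / M%:R|.
Let a (x : T) : I := [ffun j => inord (Num.truncn (f j x * M%:R))].

Let M0 : 0 < M%:R :> R. Proof. by rewrite ltr0n. Qed.

Let trunc_le (r : R) : 0 <= r <= 1 -> (Num.truncn (r * M%:R) < M.+1)%N.
Proof.
move=> /andP[r0 r1]; rewrite ltnS -[leqRHS](@natrK R); apply: le_truncn.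
by rewrite ler_piMl // ltW.
Qed.

Let trunc_dist (r : R) : 0 <= r <= 1 ->
  0 <= r - (inord (Num.truncn (r * M%:R)) : 'I_M.+1)%:R / M%:R <= M%:R^-1.
Proof.
move=> r01; rewrite inordK ?trunc_le //; have /andP[r0 _] := r01.
have /andP[lo hi] : (Num.truncn (r * M%:R))%:R <= r * M%:R <
    (Num.truncn (r * M%:R)).+1%:R by rewrite truncn_itv // mulr_ge0 // ltW.
rewrite subr_ge0 ler_pdivrMr // lo /= lerBlDr -[X in X + _]mul1r -mulrDl.
by rewrite ler_pdivlMr // [1 + _]addrC natr1 ltW.
Qed.

Let cell_dist j x : `|f j x - (a x j)%:R / M%:R| <= M%:R^-1.
Proof.
rewrite ffunE; have /andP[r0 r1] := trunc_dist (f01 j x).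
by rewrite ger0_norm.
Qed.

Let D_ge0 k l : 0 <= D k l. Proof. exact: bigmax_ge_id. Qed.

Let D_refl k : D k k = 0.
Proof.
apply/le_anti; rewrite D_ge0 andbT; apply: bigmax_le => // j _.
by rewrite subrr normr0.
Qed.

Let grid01 (i : 'I_M.+1) : 0 <= (i%:R / M%:R : R) <= 1.
Proof.
apply/andP; split; first by rewrite divr_ge0 // ltW.
by rewrite ler_pdivrMr // mul1r ler_nat -ltnS.
Qed.

Let D_le1 k l : D k l <= 1.
Proof.
apply: bigmax_le => // j _; rewrite ler_norml.
have /andP[? ?] := grid01 (k j); have /andP[? ?] := grid01 (l j).
by apply/andP; split; lra.
Qed.

Let D_triangle k l m : D k m <= D k l + D l m.
Proof.
apply: bigmax_le => [|j _]; first by rewrite addr_ge0.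
apply: le_trans (ler_distD ((l j)%:R / M%:R) _ _) _.
by apply: lerD; exact: le_bigmax.
Qed.

Let measurable_cell i : measurable (a @^-1` [set i]).
Proof.
rewrite (_ : _ @^-1` _ = \bigcap_(j in [set: J])
    [set x | (inord (Num.truncn (f j x * M%:R)) : 'I_M.+1) = i j]); last first.
  apply/seteqP; split => [x /= <- j _ /=|x /= h]; first by rewrite ffunE.
  by apply/ffunP => j; rewrite ffunE; exact: h.
apply: fin_bigcap_measurable => // j _.
rewrite (_ : [set _ | _] = f j @^-1`
  `[(i j)%:R / M%:R, (i j).+1%:R / M%:R[%classic).
  by rewrite -[X in measurable X]setTI; exact: mf.
apply/seteqP; split => x /=; rewrite in_itv /=; have fx := f01 j x.
  move=> <-; rewrite inordK ?trunc_le //; have /andP[f0 _] := fx.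
  by rewrite ler_pdivrMr // ltr_pdivlMr // truncn_itv // mulr_ge0 // ltW.
rewrite ler_pdivrMr // ltr_pdivlMr // => h.
apply: val_inj; rewrite /= inordK ?trunc_le //.
exact: truncn_def.
Qed.

Let cell_integral (m : {measure set T -> \bar R}) (h : I -> R) :
  m setT = 1%E -> (forall i, 0 <= h i) ->
  \int[m]_x h (a x) = \sum_i h i * fine (m (a @^-1` [set i])).
Proof.
move=> m1 h0; rewrite /Rintegral.
rewrite (eq_integral
  (fun x => \sum_i (h i)%:E * (\1_(a @^-1` [set i]) x)%:E)%E); last first.
  move=> x _; rewrite (bigD1 (a x)) //= indicE mem_set // mule1 big1 ?adde0 //.
  move=> i iax; rewrite indicE memNset ?mule0 // => /= xi.
  by rewrite xi eqxx in iax.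
rewrite ge0_integral_sum_indic // -sum_fine => [|i _].
  by apply: eq_bigr => i _; rewrite fineM // prob_fin_num.
by rewrite fin_numM // prob_fin_num.
Qed.

Let measurable_cell_fun (h : I -> R) : measurable_fun setT (fun x => h (a x)).
Proof.
rewrite (_ : (fun x => _) = fun x => \sum_i h i * \1_(a @^-1` [set i]) x).
  apply: measurable_sum => i; apply: measurable_funM; first exact: measurable_cst.
  by apply: measurable_indic; exact: measurable_cell.
apply/funext => x; rewrite (bigD1 (a x)) //= indicE mem_set // mulr1 big1 ?addr0 //.
move=> i iax; rewrite indicE memNset ?mulr0 // => /= xi.
by rewrite xi eqxx in iax.
Qed.

(* [psi eta] is the McShane-type extension
   [x |-> min(1, min_k (eta k / M + dist (x, k)))] of the potential [eta]. *)
Variable psi : {ffun I -> 'I_M.+1} -> T -> R.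
Hypothesis mpsi : forall eta, measurable_fun setT (psi eta).
Hypothesis psi01 : forall eta x, 0 <= psi eta x <= 1.
Hypothesis psi_le : forall eta x k,
  psi eta x <= (eta k)%:R / M%:R + grid_dist f k x.
Hypothesis psi_ge : forall (eta : {ffun I -> 'I_M.+1}) x v, v <= 1 ->
  (forall k, v <= (eta k)%:R / M%:R + grid_dist f k x) -> v <= psi eta x.

(** With [eta] the rounding of [h], a Lipschitz [h] agrees with its extension up to [1 / M] for
    rounding [h] and [1 / M] for rounding [x] to its cell. *)
Let psi_approx (h : I -> R) : (forall k, 0 <= h k <= 1) ->
  (forall k l, h k - h l <= D k l) ->
  exists eta, forall x, `|h (a x) - psi eta x| <= 2 * M%:R^-1.
Proof.
move=> h01 hlip; exists [ffun k => inord (Num.truncn (h k * M%:R))] => x.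
set eta := [ffun _ => _].
have etaE k : 0 <= h k - (eta k)%:R / M%:R <= M%:R^-1.
  by rewrite ffunE; exact: trunc_dist.
have dist_cell : grid_dist f (a x) x <= M%:R^-1.
  by apply: bigmax_le => [|j _]; [rewrite invr_ge0 ltW|exact: cell_dist].
rewrite ler_norml; apply/andP; split.
  have := psi_le eta x (a x); have /andP[? ?] := etaE (a x).
  by move: dist_cell; lra.
rewrite lerBlDr -lerBlDl; apply: psi_ge => [|k].
  have /andP[_ h1] := h01 (a x).
  have Mi : 0 <= M%:R^-1 :> R by rewrite invr_ge0 ltW.
  by lra.
have Dk : D (a x) k <= grid_dist f k x + M%:R^-1.
  apply: bigmax_le => [|j _].
    by apply: addr_ge0; [exact: bigmax_ge_id|rewrite invr_ge0 ltW].
  apply: le_trans (ler_distD (f j x) _ _) _; rewrite addrC; apply: lerD.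
    by apply: (le_bigmax _ (fun j => `|f j x - (k j)%:R / M%:R|)).
  by rewrite distrC; exact: cell_dist.
by have := hlip (a x) k; have /andP[? ?] := etaE k; lra.
Qed.

(** Of the error [6 / M], [4 / M] comes from replacing the potential by [psi eta] in two integrals,
    and [2 / M] from replacing the differences of [f j] by those of cell labels. *)
Lemma Wasserstein_grid_le (m : T -> T -> \bar R) (K : set T) (e1 e2 : R) :
  measurable K -> (mu (~` K) <= e2%:E)%E -> (nu (~` K) <= e2%:E)%E ->
  0 <= e1 -> (forall u v, 0 <= m u v <= 1)%E ->
  (forall u v, K u -> K v ->
    exists j, (m u v <= (`|f j u - f j v| + e1)%:E)%E) ->
  exists eta, (Wasserstein m mu nu <=
    (`|\int[mu]_x psi eta x - \int[nu]_x psi eta x| +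
      6 * M%:R^-1 + e1 + 2 * e2)%:E)%E.
Proof.
move=> mK muK nuK e10 m01 mle.
have Mi : 0 <= M%:R^-1 :> R by rewrite invr_ge0 ltW.
pose gap eta := `|\int[mu]_x psi eta x - \int[nu]_x psi eta x|.
(* [eta] maximises the gap, so its gap bounds that of every rounded potential in the duality. *)
have [eta etaP] := finite_argmin [ffun=> ord0] (fun eta => - gap eta).
exists eta; rewrite -/(gap eta).
pose A i := a @^-1` [set i].
have cell_fin (n : {measure set T -> \bar R}) i : n setT = 1%E ->
    (fine (n (A i)))%:E = n (A i).
  by move=> n1; rewrite fineK // prob_fin_num //; exact: measurable_cell.
have cell_sum1 (n : {measure set T -> \bar R}) : n setT = 1%E ->
    \sum_i fine (n (A i)) = 1.
  move=> n1; have := cell_integral n1 (fun=> ler01).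
  rewrite Rintegral_prob_cst // => ->.
  by apply: eq_bigr => i _; rewrite mul1r.
have [i|i|h h01 hlip|g [g0 g_row g_col g_cost]] :=
  @finite_kantorovich_rubinstein R I
    (fun i => fine (mu (A i))) (fun i => fine (nu (A i))) D
    (gap eta + 4 * M%:R^-1) _ _ (cell_sum1 mu mu1) (cell_sum1 nu nu1)
    D_refl D_le1 D_triangle.
- by rewrite fine_ge0.
- by rewrite fine_ge0.
- have h0 i : 0 <= h i by have /andP[] := h01 i.
  rewrite -!cell_integral //; have [eta' eta'P] := psi_approx h01 hlip.
  have hn1 x : `|h (a x)| <= 1 by have /andP[? ?] := h01 (a x); rewrite ger0_norm.
  have pn1 x : `|psi eta' x| <= 1.
    by have /andP[? ?] := psi01 eta' x; rewrite ger0_norm.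
  have := Rintegral_prob_dist mu1 (measurable_cell_fun h) hn1 (mpsi eta') pn1 eta'P.
  have := Rintegral_prob_dist nu1 (measurable_cell_fun h) hn1 (mpsi eta') pn1 eta'P.
  have := etaP eta'; rewrite lerN2 {1}/gap => gap_le.
  have := ler_norm (\int[mu]_x psi eta' x - \int[nu]_x psi eta' x).
  by rewrite !ler_norml => ? /andP[? ?] /andP[? ?]; lra.
have g_rowE i : (\sum_j g i j)%:E = mu (A i) by rewrite g_row cell_fin.
have g_colE j : (\sum_i g i j)%:E = nu (A j) by rewrite g_col cell_fin.
have e1M : 0 <= e1 + 2 * M%:R^-1 by lra.
apply: le_trans (Wasserstein_block_le mu1 nu1 measurable_cell g0 g_rowE g_colE
  mK muK nuK D_ge0 e1M m01 _) _; last by rewrite lee_fin; lra.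
move=> u v Ku Kv; have [j /le_trans] := mle u v Ku Kv; apply.
rewrite lee_fin.
have := le_bigmax 0 (fun j => `|(a u j)%:R / M%:R - (a v j)%:R / M%:R : R|) j.
rewrite -/(D (a u) (a v)).
have := cell_dist j u; have := cell_dist j v; have := D_ge0 (a u) (a v).
move=> _; rewrite !ler_norml => /andP[? ?] /andP[? ?] Dj.
suff : `|f j u - f j v| <= D (a u) (a v) + 2 * M%:R^-1 by lra.
move: Dj; rewrite !ler_norml => /andP[? ?].
by apply/andP; split; lra.
Qed.

End grid.

(** * Formulas *)

Lemma minr_dist_le (R : realDomainType) (a b a' b' m : R) :
  `|a - a'| <= m -> `|b - b'| <= m -> `|Num.min a b - Num.min a' b'| <= m.
Proof.
rewrite !ler_norml => /andP[? ?] /andP[? ?].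
by apply/andP; case: (leP a b) => ?; case: (leP a' b') => ?; split; lra.
Qed.

Section formulas.
Variables (R : realType) (E : ptopologicalType) (X : CTMP R E) (c : R).
Hypothesis E_locally_compact : locally_compact [set: E].
Hypothesis E_hausdorff : hausdorff_space E.
Hypothesis E_second_countable : @second_countable E.
Hypotheses (c_gt0 : 0 < c) (c_lt1 : c < 1).

Local Notation interp := (interp X c).
Local Notation k := (ctmp_kernel X).

Lemma discount_01 t : 0 <= t -> 0 <= c `^ t <= 1.
Proof.
move=> t0; rewrite powR_ge0 /= -[leRHS](powRr0 c).
by rewrite ger_powR // c_gt0 ltW.
Qed.

(** The two claims are proved together, since continuity under the modality uses the bounds on the
    subformula. *)
Lemma interp_01_continuous phi :
  (forall x, 0 <= interp phi x <= 1) /\ continuous (interp phi).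
Proof.
elim: phi => [q /andP[q0 q1]||f1 [f1P c1] f2 [f2P c2]|f [fP cf]
    |f [fP cf] q /andP[q0 q1]|t t0 f [fP cf]] /=.
- split=> x; last exact: cvg_cst.
  by rewrite ler0q q0 -[X in _ <= X](rmorph1 (ratr : rat -> R)) ler_rat.
- by split; [exact: ctmp_obs01|exact: ctmp_obs_continuous].
- split=> x; last exact: continuous_min (c1 x) (c2 x).
  have /andP[? ?] := f1P x; have /andP[? ?] := f2P x.
  by rewrite le_min ge_min; apply/andP; split; [apply/andP|apply/orP; left].
- split=> x; last by apply: cvgB; [exact: cvg_cst|exact: cf].
  by have := fP x; lra.
- split=> x.
    have /andP[? ?] := fP x; have : 0 <= ratr q :> R by rewrite ler0q.
    by rewrite le_max lexx ge_max ler01 /=; lra.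
  apply: (@continuous_max _ _ (fun=> 0) (fun x => interp f x - ratr q)).
    exact: cvg_cst.
  by apply: cvgB; [exact: cf|exact: cvg_cst].
- have rt0 : 0 <= ratr t :> R by rewrite ler0q.
  split=> x.
    have /andP[? ?] := discount_01 rt0.
    have /andP[? ?] := kernel_01 X (ratr t) x cf fP.
    by rewrite mulr_ge0 // mulr_ile1.
  apply: cvgM; first exact: cvg_cst.
  by apply: kernel_continuous => //; exact: fP.
Qed.

Let interp_01 phi x : 0 <= interp phi x <= 1.
Proof. by have [+ _] := interp_01_continuous phi; exact. Qed.

Let interp_continuous phi : continuous (interp phi).
Proof. by have [] := interp_01_continuous phi. Qed.

Let interp_measurable phi : measurable_fun [set: borel E] (interp phi).
Proof. exact: continuous_borel_measurable. Qed.

Let interp_FMin f1 f2 x :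
  interp (FMin f1 f2) x = Num.min (interp f1 x) (interp f2 x).
Proof. by []. Qed.

Let interp_FNeg f x : interp (FNeg f) x = 1 - interp f x.
Proof. by []. Qed.

Let interp_FSub f q (q01 : 0 <= q <= 1) x :
  interp (FSub f q01) x = Num.max 0 (interp f x - ratr q).
Proof. by []. Qed.

(** * Derived connectives and the formulas for grid potentials *)

Definition FMax (f1 f2 : formula) := FNeg (FMin (FNeg f1) (FNeg f2)).

Lemma interp_FMax f1 f2 x :
  interp (FMax f1 f2) x = Num.max (interp f1 x) (interp f2 x).
Proof. by rewrite /=; case: leP => ?; case: leP => ?; lra. Qed.

Definition FAdd (f : formula) (q : rat) (q01 : 0 <= q <= 1) :=
  FNeg (FSub (FNeg f) q01).

Lemma interp_FAdd f q (q01 : 0 <= q <= 1) x :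
  interp (FAdd f q01) x = Num.min 1 (interp f x + ratr q).
Proof. by rewrite /=; case: leP => ?; case: leP => ?; lra. Qed.

Lemma onem_rat01 (q : rat) : 0 <= q <= 1 -> 0 <= 1 - q <= 1.
Proof. by lra. Qed.

(** The second branch is the truncated difference of [q] and [f], written [1 - min(1, f + (1 - q))]
    because the grammar subtracts only constants. *)
Definition FDist (f : formula) (q : rat) (q01 : 0 <= q <= 1) :=
  FMax (FSub f q01) (FNeg (FAdd f (onem_rat01 q01))).

Lemma interp_FDist f q (q01 : 0 <= q <= 1) x :
  interp (FDist f q01) x = `|interp f x - ratr q|.
Proof.
rewrite interp_FMax interp_FNeg interp_FAdd interp_FSub rmorphB rmorph1.
have /andP[? ?] := interp_01 f x.
case: (leP 0 (interp f x - ratr q)) => ?;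
  case: (leP 1 (interp f x + (1 - ratr q))) => ?;
  by case: leP => ?; case: ler0P => ?; lra.
Qed.

Lemma grid_rat01 M (i : 'I_M.+1) : 0 <= (i%:R / M%:R : rat) <= 1.
Proof.
rewrite divr_ge0 //=; case: M i => [|M] i; first by rewrite invr0 mulr0.
by rewrite ler_pdivrMr ?ltr0n // mul1r ler_nat -ltnS.
Qed.

Lemma ratr_grid M (i : 'I_M.+1) : ratr (i%:R / M%:R) = i%:R / M%:R :> R.
Proof. by rewrite fmorph_div /= !ratr_nat. Qed.

Lemma rat01_0 : 0 <= (0 : rat) <= 1. Proof. by []. Qed.
Lemma rat01_1 : 0 <= (1 : rat) <= 1. Proof. by []. Qed.

Section grid_formula.
Variables (J : finType) (F : J -> formula) (M : nat).

Definition FGridDist (l : {ffun J -> 'I_M.+1}) : formula :=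
  foldr (fun j => FMax (FDist (F j) (grid_rat01 (l j)))) (FConst rat01_0)
    (enum J).

Lemma interp_FGridDist l x :
  interp (FGridDist l) x = grid_dist (fun j => interp (F j)) l x.
Proof.
rewrite /grid_dist -big_enum /FGridDist /=.
elim: (enum J) => [|j s IH]; first by rewrite big_nil /= rmorph0.
by rewrite big_cons -IH [foldr _ _ _]/= interp_FMax interp_FDist ratr_grid.
Qed.

(** This formula plays the role of [psi eta] above. The base constant and [FAdd] cap it at 1, whence
    [v <= 1] in [interp_FGrid_ge]. *)
Definition FGrid (eta : {ffun {ffun J -> 'I_M.+1} -> 'I_M.+1}) : formula :=
  foldr (fun l => FMin (FAdd (FGridDist l) (grid_rat01 (eta l))))
    (FConst rat01_1) (enum {: {ffun J -> 'I_M.+1}}).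

Lemma interp_FGrid_le eta x l :
  interp (FGrid eta) x <=
    (eta l)%:R / M%:R + grid_dist (fun j => interp (F j)) l x.
Proof.
rewrite /FGrid; have : l \in enum {: {ffun J -> 'I_M.+1}} by rewrite mem_enum.
elim: (enum _) => // l' s IH; rewrite inE [foldr _ _ _]/=.
rewrite interp_FMin => /orP[/eqP<-|/IH le_s].
  by rewrite ge_min interp_FAdd ge_min ratr_grid interp_FGridDist addrC lexx orbT.
by rewrite ge_min le_s orbT.
Qed.

Lemma interp_FGrid_ge (eta : {ffun {ffun J -> 'I_M.+1} -> 'I_M.+1}) x v :
  v <= 1 ->
  (forall l, v <= (eta l)%:R / M%:R + grid_dist (fun j => interp (F j)) l x) ->
  v <= interp (FGrid eta) x.
Proof.
move=> v1 vl; rewrite /FGrid; elim: (enum _) => [|l s IH].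
  by rewrite /= rmorph1.
rewrite [foldr _ _ _]/= interp_FMin le_min IH andbT interp_FAdd le_min v1.
by rewrite interp_FGridDist ratr_grid addrC vl.
Qed.

End grid_formula.

Let k1 t x : k t x setT = 1%E. Proof. exact: prob_kernel. Qed.

Lemma Wasserstein_01 (m : E -> E -> \bar R)
    (mu nu : {measure set (borel E) -> \bar R}) :
  mu setT = 1%E -> nu setT = 1%E -> (forall x y, 0 <= m x y <= 1)%E ->
  (0 <= @Wasserstein R _ (borel E) m mu nu <= 1)%E.
Proof.
move=> mu1 nu1 m01; apply/andP; split.
  apply: le_ereal_inf_tmp => _ [G _ <-].
  by apply: integral_ge0 => z _; have /andP[] := m01 z.1 z.2.
have preT (i : unit) : (fun _ : borel E => tt) @^-1` [set i] = setT.
  by apply/seteqP; split => // y _; case: i.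
have ma (i : unit) : measurable ((fun _ : borel E => tt) @^-1` [set i]).
  by rewrite preT.
have sum1 : \sum_(j : unit) (1 : R) = 1 by rewrite big_const card_unit /= addr0.
(* A partition into a single cell makes the block coupling the product coupling. *)
apply: le_trans (@Wasserstein_block_le R _ (borel E) mu nu mu1 nu1 unit (fun=> tt)
  (fun _ _ => 1) ma _ _ _ m setT (fun _ _ => 1) 0 0 _ _ _ _ _ m01 _) _ => //.
- by move=> i; rewrite sum1 preT mu1.
- by move=> i; rewrite sum1 preT nu1.
- by rewrite setCT measure0.
- by rewrite setCT measure0.
- by move=> u v _ _; rewrite addr0; have /andP[] := m01 u v.
by rewrite mulr1 sum1 sum1 mulr0 !addr0.
Qed.

(** * Comparison of [delta] with the formulas *)

Local Notation W m t x y := (@Wasserstein R _ (borel E) m (k t x) (k t y)).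

Lemma delta_01 n x y : (0 <= delta X c n x y <= 1)%E.
Proof.
elim: n x y => [|n IH] x y /=.
  rewrite !lee_fin normr_ge0 /= ler_norml.
  have /andP[? ?] := ctmp_obs01 X x; have /andP[? ?] := ctmp_obs01 X y.
  by apply/andP; split; lra.
have W01 t : (0 <= W (delta X c n) t x y <= 1)%E by exact: Wasserstein_01.
apply/andP; split.
  apply: (@le_trans _ _ ((c `^ 0)%:E * W (delta X c n) 0 x y)%E).
    by rewrite mule_ge0 ?lee_fin ?powR_ge0 //; have /andP[] := W01 0.
  by apply: ereal_sup_ubound; exists 0 => //=.
apply: ge_ereal_sup => _ [t /= t0 <-].
have /andP[c0 c1] := discount_01 t0; have /andP[W0 W1] := W01 t.
by rewrite -[1%E]mule1; apply: lee_pmul; rewrite ?lee_fin.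
Qed.

Lemma le_delta_discount n (g : E -> R) :
  continuous g -> (forall x, 0 <= g x <= 1) ->
  (forall x y, ((`|g x - g y|)%:E <= delta X c n x y)%E) ->
  forall t x y, 0 <= t ->
  ((`|c `^ t * \int[k t x]_z g z - c `^ t * \int[k t y]_z g z|)%:E <=
    delta X c n.+1 x y)%E.
Proof.
move=> cg g01 gn t x y t0; have /andP[c0 c1] := discount_01 t0.
apply: (@le_trans _ _ ((c `^ t)%:E * W (delta X c n) t x y)%E); last first.
  by apply: ereal_sup_ubound; exists t.
rewrite -mulrBr normrM (ger0_norm c0) EFinM.
apply: lee_wpmul2l; first by rewrite lee_fin.
apply: le_ereal_inf_tmp => _ [G GP <-].
have := coupling_integral_dist (continuous_borel_measurable cg) g01 GP.
move=> /le_trans; apply.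
by apply: le_integral_nonmeasurable => z; rewrite ?lee_fin.
Qed.

(** The case of time 0, where discount and kernel act trivially. It brings subformulas to a common
    level without comparing the [delta] themselves. *)
Lemma le_deltaS n (g : E -> R) : continuous g -> (forall x, 0 <= g x <= 1) ->
  (forall x y, ((`|g x - g y|)%:E <= delta X c n x y)%E) ->
  forall x y, ((`|g x - g y|)%:E <= delta X c n.+1 x y)%E.
Proof.
move=> cg g01 gn x y; have := le_delta_discount cg g01 gn x y (lexx 0).
by rewrite powRr0 !mul1r !kernel0.
Qed.

Lemma le_delta_leq n m (g : E -> R) : (n <= m)%N ->
  continuous g -> (forall x, 0 <= g x <= 1) ->
  (forall x y, ((`|g x - g y|)%:E <= delta X c n x y)%E) ->
  forall x y, ((`|g x - g y|)%:E <= delta X c m x y)%E.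
Proof.
move=> nm cg g01 gn; rewrite -(subnK nm); elim: (m - n)%N => [//|i IH].
by rewrite addSn; exact: le_deltaS.
Qed.

Lemma formula_le_delta phi : exists n, forall x y,
  ((`|interp phi x - interp phi y|)%:E <= delta X c n x y)%E.
Proof.
elim: phi => [q q01||f1 [n1 IH1] f2 [n2 IH2]|f [n IH]|f [n IH] q q01
    |t t0 f [n IH]].
- by exists 0 => x y /=; rewrite subrr normr0 lee_fin.
- by exists 0.
- exists (maxn n1 n2) => x y.
  have := le_delta_leq (leq_maxl n1 n2) (@interp_continuous f1) (interp_01 f1)
    IH1 x y.
  have := le_delta_leq (leq_maxr n1 n2) (@interp_continuous f2) (interp_01 f2)
    IH2 x y.
  have [le12|/ltW le21] :=
    leP `|interp f1 x - interp f1 y| `|interp f2 x - interp f2 y|.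
    by move=> + _; apply: le_trans; rewrite lee_fin; exact: minr_dist_le.
  by move=> _; apply: le_trans; rewrite lee_fin; exact: minr_dist_le.
- exists n => x y /=; apply: le_trans (IH x y); rewrite lee_fin.
  by rewrite [X in `|X|](_ : _ = interp f y - interp f x) 1?distrC //; ring.
- exists n => x y /=; apply: le_trans (IH x y); rewrite lee_fin.
  have := ler_norm (interp f x - interp f y).
  have := ler_norm (interp f y - interp f x); rewrite [X in _ <= X -> _]distrC.
  rewrite ler_norml => ? ?; apply/andP.
  by case: (leP 0 (interp f x - _)) => ?; case: (leP 0 (interp f y - _)) => ?;
    split; lra.
- exists n.+1 => x y; apply: (le_delta_discount (@interp_continuous f) (interp_01 f) IH).
  by rewrite ler0q.
Qed.

Lemma delta_net n : forall (K : set E) (e : R), compact K -> 0 < e ->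
  exists (J : finType) (F : J -> formula), forall x y, K x -> K y ->
    exists j, (delta X c n x y <= (`|interp (F j) x - interp (F j) y| + e)%:E)%E.
Proof.
elim: n => [|n IH] K e cK e0.
  exists unit, (fun=> FObs) => x y _ _; exists tt; rewrite /= lee_fin; lra.
(* For times up to [t0] the errors total at most [11 * e']: [6 * e'] for the grid, [e'] for the
   induction hypothesis, [2 * e'] for tightness and [2 * e'] for rounding the time at [x] and at
   [y]. *)
pose e' := e / 16; have e'0 : 0 < e' by rewrite /e'; lra.
have lnc : ln c < 0 by rewrite ln_lt0 // c_gt0.
(* The quotient solves [c ^ t = e]; it is negative when [e > 1], hence the maximum. *)
pose t0 := Num.max 0 (ln e / ln c).
have t0_ge0 : 0 <= t0 by rewrite le_max lexx.
have discount_small t : t0 <= t -> c `^ t <= e.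
  rewrite ge_max => /andP[t_ge0 t_ln]; rewrite /powR gt_eqF // -[leRHS]lnK ?posrE //.
  by rewrite ler_expR -ler_ndivrMr.
have [K' cK' tight] := feller_tight_set X E_locally_compact E_hausdorff
  E_second_countable t0 cK e'0.
have mK' := compact_borel_measurable E_hausdorff cK'.
have [J [F FP]] := IH K' e' cK' e'0.
pose M := (Num.truncn e'^-1).+1.
have M0 : 0 < M%:R :> R by rewrite ltr0n.
have Me : M%:R^-1 <= e'.
  by rewrite invf_ple ?posrE // ltW // truncnS_gt.
pose psi := @FGrid J F M.
have /choice[s sP] : forall eta, exists s : seq rat,
    (forall q, q \in s -> 0 <= q) /\
    forall t, 0 <= t <= t0 -> exists2 q, q \in s & forall x, K x ->
      `|c `^ t * \int[k t x]_z interp (psi eta) z -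
        c `^ (ratr q) * \int[k (ratr q) x]_z interp (psi eta) z| <= e'.
  by move=> eta; apply: finite_time_net => //; exact: interp_01.
(* A common length, so that one finite type indexes the times of all [eta]. *)
pose N := \max_eta size (s eta).
(* The times in [s eta] are nonnegative; the absolute value only provides a
   proof of this for indices beyond the end of [s eta] too. *)
pose F' (o : option ({ffun {ffun J -> 'I_M.+1} -> 'I_M.+1} * 'I_N)) :=
  if o is Some (eta, i) then FDiamond (normr_ge0 (nth 0 (s eta) i)) (psi eta)
  else FConst rat01_0.
exists (option ({ffun {ffun J -> 'I_M.+1} -> 'I_M.+1} * 'I_N)), F' => x y Kx Ky.
(* One [j] must serve every time in the supremum, so the largest difference is taken; [None] keeps
   the index type inhabited even if [N = 0]. *)
have [j jmax] := finite_argmin None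
  (fun o => - `|interp (F' o) x - interp (F' o) y|).
exists j; apply: ge_ereal_sup => _ [t /= t_ge0 <-].
have m01 := delta_01 n.
have /andP[W0 W1] := Wasserstein_01 (k1 t x) (k1 t y) m01.
have /andP[c0 c1] := discount_01 t_ge0.
have [tt0|/ltW t0t] := leP t t0; last first.
  apply: (@le_trans _ _ (e%:E * 1)%E).
    by apply: lee_pmul => //; rewrite lee_fin ?discount_small.
  by rewrite mule1 lee_fin lerDr.
have tI : 0 <= t <= t0 by rewrite t_ge0.
have [eta etaP] := @Wasserstein_grid_le R _ (borel E) (k t x) (k t y) (k1 t x)
  (k1 t y) J (fun j => interp (F j)) M isT (fun j => interp_measurable (F j))
  (fun j => interp_01 (F j)) (fun eta => interp (psi eta))
  (fun eta => interp_measurable (psi eta)) (fun eta => interp_01 (psi eta))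
  (@interp_FGrid_le J F M) (@interp_FGrid_ge J F M)
  (delta X c n) K' e' e' mK' (tight t x tI Kx) (tight t y tI Ky) (ltW e'0) m01 FP.
have [s0 /(_ t tI)[q qs qP]] := sP eta.
have qN : (index q (s eta) < N)%N.
  by apply: leq_trans (leq_bigmax eta); rewrite index_mem.
have := jmax (Some (eta, Ordinal qN)); rewrite lerN2 => jle.
apply: (@le_trans _ _ ((c `^ t)%:E * (`|\int[k t x]_z interp (psi eta) z -
  \int[k t y]_z interp (psi eta) z| + 6 * M%:R^-1 + e' + 2 * e')%:E)%E).
  by apply: lee_pmul.
rewrite -EFinM lee_fin -lerBlDr; apply: le_trans _ jle.
rewrite /F' /= nth_index // (ger0_norm (s0 q qs)).
have := qP x Kx; have := qP y Ky.
set Px := \int[k t x]_z _; set Py := \int[k t y]_z _.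
set Qx := _ * \int[k (ratr q) x]_z _; set Qy := _ * \int[k (ratr q) y]_z _.
move=> hy hx.
have : c `^ t * `|Px - Py| <= `|Qx - Qy| + 2 * e'.
  rewrite -[X in X * _](ger0_norm c0) -normrM mulrBr.
  apply: le_trans (ler_distD Qx _ _) _.
  have := ler_distD Qy Qx (c `^ t * Py); rewrite distrC in hy; lra.
have : c `^ t * (6 * M%:R^-1 + e' + 2 * e') <= 9 * e'.
  have M1 : 0 <= M%:R^-1 :> R by rewrite invr_ge0 ltW.
  apply: (@le_trans _ _ (1 * (6 * M%:R^-1 + e' + 2 * e'))); last by lra.
  by apply: ler_wpM2r => //; lra.
have : e = 16 * e' by rewrite /e'; field.
rewrite !mulrDr; lra.
Qed.

End formulas.

Theorem theorem4 (R : realType) (E : ptopologicalType)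
    (E_locally_compact : locally_compact [set: E])
    (E_hausdorff : hausdorff_space E)
    (E_second_countable : @second_countable E)
    (X : CTMP R E) (c : R) (c_gt0 : 0 < c) (c_lt1 : c < 1) :
  forall x y : E, delta_bar X c x y = lambda X c x y.
Proof.
move=> x y; apply/le_anti/andP; split.
  apply: ge_ereal_sup => _ [n _ <-]; apply/lee_addgt0Pr => e e0.
  (* The net over this two-point set yields a formula reaching [delta X c n x y] up to [e]. *)
  have cK : compact [set x; y] by apply: compactU; exact: compact_set1.
  have [J [F FP]] := delta_net X E_locally_compact E_hausdorff
    E_second_countable c_gt0 c_lt1 n cK e0.
  have [j /le_trans] := FP x y (or_introl erefl) (or_intror erefl); apply.
  rewrite EFinD leeD2r //; apply: ereal_sup_ubound.
  by exists (interp X c (F j)) => //; exists (F j).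
apply: ge_ereal_sup => _ [_ [phi _ <-] <-].
have [n nP] := formula_le_delta X E_locally_compact E_hausdorff
  E_second_countable c_gt0 c_lt1 phi.
by apply: le_trans (nP x y) _; apply: ereal_sup_ubound; exists n.
Qed.
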